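(* Let $a>0$, $b\in\mathbb{R}$ and $u>0$, where in the case $b<0$ it is required that $u<-a/b$ (there is no constraint on $u$ if $b\ge 0$). Then $$\mathbf{P}^{RBM}_0\left(H_{a,b}>u\right)=\lim_{N\to\infty}\sum_{k=-N}^{N}(-1)^k e^{-2k^2ab}\left(\Phi\left(\frac{a+bu-2ka}{\sqrt u}\right)-\Phi\left(-\frac{a+bu-2ka}{\sqrt u}\right)\right).$$ The density, with the same constraints on $u$, is given by $$\mathbf{P}^{RBM}_0\left(H_{a,b}\in du\right)/du=\Delta_{a,b}(u):=\frac{1}{\sqrt{2\pi u^3}}\sum_{k=-\infty}^{+\infty}(-1)^k(a-bu-2ka)\,e^{-2k^2ab}\,e^{-(a+bu-2ka)^2/(2u)}.$$ Moreover, in the case $b>0$, $$\mathbf{P}^{RBM}_0\left(\omega_{H_{a,b}}>y\right)=\begin{cases}\mathbf{P}^{RBM}_0\left(H_{a,b}>\frac{y-a}{b}\right), & y>a,\\ 1, & y\le a,\end{cases}$$ and for $y>a$ $$\mathbf{P}^{RBM}_0\left(\omega_{H_{a,b}}\in dy\right)/dy=\frac1b\,\Delta_{a,b}\left(\frac{y-a}{b}\right);$$ in the case $b<0$, $$\mathbf{P}^{RBM}_0\left(\omega_{H_{a,b}}<y\right)=\begin{cases}\mathbf{P}^{RBM}_0\left(H_{a,b}>\frac{y-a}{b}\right), & y<a,\\ 1, & y\ge a,\end{cases}$$ and for $0<y<a$ $$\mathbf{P}^{RBM}_0\left(\omega_{H_{a,b}}\in dy\right)/dy=\frac1{|b|}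\,\Delta_{a,b}\left(\frac{y-a}{b}\right).$$
   Context: $\mathbf{P}^{RBM}_0$ is the law, on the space of continuous functions $\omega:[0,\infty)\to\mathbb{R}$ with coordinate process $\omega_t=\omega(t)$, of reflecting Brownian motion started at $0$, i.e. the law of $|B|$ where $B$ is a standard one-dimensional Brownian motion with $B_0=0$. $H_{a,b}:=\inf\{t:\ \omega_t=a+bt\}$ (with $\inf\emptyset=+\infty$); for $b>0$ the event $\{H_{a,b}=\infty\}$ can have positive probability, and on it one puts $\omega_{H_{a,b}}:=+\infty$. ''Density'' means density of the (possibly defective) law restricted to the indicated range. $\Phi(x)=\int_{-\infty}^x\frac{1}{\sqrt{2\pi}}e^{-y^2/2}\,dy$ is the standard normal distribution function. *)

(* Defs.v *)
From HB Require Import structures.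
From mathcomp Require Import all_boot all_order all_algebra.
From mathcomp Require Import all_classical all_reals all_analysis.

Set Implicit Arguments.
Unset Strict Implicit.
Unset Printing Implicit Defensive.

Import Order.TTheory GRing.Theory Num.Theory.
Import numFieldTopology.Exports numFieldNormedType.Exports.

Local Open Scope classical_set_scope.
Local Open Scope ring_scope.

Definition half_line (R : realType) : Type :=
  set_type (`[0%R, +oo[%classic : set R).

Coercion time_val (R : realType) (t : half_line R) : R := set_val t.

Lemma half_line0_subproof (R : realType) :
  (0 : R) \in (`[0%R, +oo[%classic : set R).
Proof. by rewrite inE /= in_itv /= lexx. Qed.

Definition time0 (R : realType) : half_line R :=
  exist _ 0 (half_line0_subproof R).

(* The real [r] as a time; the default value [time0] is only taken if r < 0. *)
Definition time_of (R : realType) (r : R) : half_line R := insubd (time0 R) r.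

HB.instance Definition _ (R : realType) := Topological.on (half_line R).

Definition cts_path (R : realType) : Type := continuousType (half_line R) R.

HB.instance Definition _ (R : realType) := Choice.on (cts_path R).
HB.instance Definition _ (R : realType) :=
  isPointed.Build (cts_path R) (cst (0 : R) : continuousType (half_line R) R).

Definition cylinders (R : realType) : set (set (cts_path R)) :=
  [set C | exists t : half_line R, exists2 A : set R,
     measurable A & C = [set w : cts_path R | A (w t)]].

(* C([0, +oo[, R) with the sigma-algebra generated by the coordinate maps. *)
Notation path_space R := (g_sigma_algebraType (@cylinders R)).

Definition increment (R : realType) (s t : half_line R) (w : cts_path R) : R :=
  w t - w s.

(* The trajectories of [B] are continuous because [B] is path-valued. *)
Definition standard_brownian_motion (R : realType) (d : measure_display)
    (Omega : measurableType d) (Q : probability Omega R)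
    (B : {RV Q >-> path_space R}) : Prop :=
  [/\ forall o, (B o : cts_path R) (time0 R) = 0,
      forall (n : nat) (t : nat -> half_line R) (A : nat -> set R),
        (forall i, t i <= t i.+1 :> R) ->
        (forall i, measurable (A i)) ->
        Q (\bigcap_(i < n) [set o | A i (increment (t i) (t i.+1) (B o))])
        = (\prod_(i < n) Q [set o | A i (increment (t i) (t i.+1) (B o))])%E
    & forall (s t : half_line R) (A : set R),
        s < t :> R -> measurable A ->
        Q [set o | A (increment s t (B o))]
        = normal_prob 0 (Num.sqrt ((t : R) - (s : R))) A].

(* [P] is the law of |B| for some standard Brownian motion B, i.e. [P] is the
   measure P_0^RBM (the law does not depend on the choice of B). *)
Definition is_RBM0_law (R : realType) (P : probability (path_space R) R)
    : Prop :=
  exists (d : measure_display) (Omega : measurableType d)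
    (Q : probability Omega R) (B X : {RV Q >-> path_space R}),
  [/\ standard_brownian_motion B,
      forall o t, (X o : cts_path R) t = `|(B o : cts_path R) t|
    & forall A : set (path_space R), measurable A -> P A = distribution Q X A].

(* [ereal_inf set0 = +oo] *)
Definition hitting_time (R : realType) (a b : R) (w : cts_path R) : \bar R :=
  ereal_inf [set (time_val t)%:E |
              t in [set t : half_line R | w t = a + b * time_val t]].

(* The constructor -oo cannot occur, a hitting time being nonnegative. *)
Definition path_at_hit (R : realType) (a b : R) (w : cts_path R) : \bar R :=
  if hitting_time a b w is r%:E then (w (time_of r))%:E else +oo%E.

Definition admissible (R : realType) (a b : R) : set R :=
  [set u | 0 < u /\ (b < 0 -> u < - a / b)].

(* The law of the extended-real variable [X] under [P], restricted to [D], has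
   density [f] with respect to Lebesgue measure; in particular an atom of the
   law at +oo is not taken into account. *)
Definition has_density_on (R : realType) (d : measure_display)
    (T : measurableType d) (P : probability T R) (X : T -> \bar R) (D : set R)
    (f : R -> R) : Prop :=
  measurable_fun D f /\
  forall A : set R, measurable A -> A `<=` D ->
    P [set w | (EFin @` A) (X w)]
    = (\int[lebesgue_measure]_(x in A) (f x)%:E)%E.

Definition Phi (R : realType) (x : R) : R :=
  Rintegral lebesgue_measure (`]-oo, x]%classic : set R)
    (fun y => (Num.sqrt (2 * pi))^-1 * expR (- y ^+ 2 / 2)).

Definition sym_sum (R : realType) (f : int -> R) (N : nat) : R :=
  \sum_(i < N.*2.+1) f (i%:Z - N%:Z).

(* Bilateral series: the two halves k >= 0 and k < 0 ([Negz n] is - (n + 1))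
   are summed separately. *)
Definition bilateral_cvg (R : realType) (f : int -> R) : Prop :=
  cvgn (series (fun n => f (Posz n))) /\ cvgn (series (fun n => f (Negz n))).

Definition bilateral_sum (R : realType) (f : int -> R) : R :=
  limn (series (fun n => f (Posz n))) + limn (series (fun n => f (Negz n))).

Definition survival_term (R : realType) (a b u : R) (k : int) : R :=
  let x := (a + b * u - 2 * k%:~R * a) / Num.sqrt u in
  (-1) ^ k * expR (- 2 * k%:~R ^+ 2 * a * b) * (Phi x - Phi (- x)).

Definition Delta_term (R : realType) (a b u : R) (k : int) : R :=
  (-1) ^ k * (a - b * u - 2 * k%:~R * a) * expR (- 2 * k%:~R ^+ 2 * a * b)
  * expR (- (a + b * u - 2 * k%:~R * a) ^+ 2 / (2 * u)).

Definition Delta (R : realType) (a b u : R) : R :=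
  (Num.sqrt (2 * pi * u ^+ 3))^-1 * bilateral_sum (Delta_term a b u).

(* Main.v *)
(* Put c = a + b u. On each interval ](2k-1)c, (2k+1)c[ let
   G(y) = (-1)^k exp (2 b k (y - k c)), and G = 0 at the odd multiples of c.
   G is even, equals 1 on ]-c, c[, and G(c + z) exp (- b z) is odd in z. By the
   Cameron-Martin formula this oddness gives E G(x + W_(u-t)) = 0 for a Brownian
   motion W and x = a + b t, and by evenness also for x = - (a + b t). The
   Markov property at the first time |B| reaches a + b t then yields
   E [G(B_u); |B| crosses before u] = 0, while G(B_u) = 1 if there is no
   crossing. Hence P(H > u) = E G(B_u), and integrating the normal density over
   the intervals one by one gives the alternating series.

   The strong Markov property is avoided by a discretisation: on a grid of mesh
   s / n, s < u, one stops at the first grid time at which |B_t| > a + b t - e,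
   where the conditional expectation of G(B_u) is at most a constant times e
   unless the path has jumped over the boundary layer. Let n -> oo, then e -> 0,
   then s -> u.

   The derivative in u of the k-th survival term is exactly minus the k-th term
   of Delta, and the latter is bounded by M z^|k|, z < 1, locally uniformly in
   u; so Delta is continuous and its integral over ]s, t] is
   P(s < H <= t). *)
Require Import Defs.
From HB Require Import structures.
From mathcomp Require Import all_boot all_order all_algebra.
From mathcomp Require Import all_classical all_reals all_analysis.
From mathcomp Require Import measurable_realfun ring lra.

Set Implicit Arguments.
Unset Strict Implicit.
Unset Printing Implicit Defensive.

Import Order.TTheory GRing.Theory Num.Theory.
Import numFieldTopology.Exports numFieldNormedType.Exports.

Import HBNNSimple.

Local Open Scope classical_set_scope.
Local Open Scope ring_scope.

(** * Gaussian integrals *)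

(** A single weight serves all contact times. At contact with remaining time r, the path stands at c
    - b r, and Cameron-Martin turns the mean of G(c - b r + W_r) into that of G(c + W_r) exp (- b
    W_r), up to a constant; the oddness that kills it does not involve r. The first obstacle is
    growth. For b > 0, G reaches exp (b y^2 / (2 c)) at the even multiples of c, against a Gaussian
    decay exp (- y^2 / (2 u)). Every integral below converges because b u < c, that is, because a >
    0. The second obstacle is uniformity in the discretisation. First entries at different grid
    times are disjoint events, and each one contributes at most K e times its probability, so the
    total is at most K e whatever the mesh. The constant K comes from an overshoot factor exp (z e /
    r) and blows up as the remaining time r tends to 0; hence the detour through times s < u. *)

Section density.
Context d (T : measurableType d) (R : realType).
Variables (mu nu : {measure set T -> \bar R}) (g : T -> R).
Hypotheses (mg : measurable_fun setT g) (g0 : forall x, 0 <= g x).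
Hypothesis nuE : forall A, measurable A -> nu A = (\int[mu]_(x in A) (g x)%:E)%E.

Local Open Scope ereal_scope.

(** The usual ladder: indicators by [nuE], simple functions by linearity, then monotone convergence
    along [nnsfun_approx]. *)
Lemma ge0_integral_density (f : T -> \bar R) :
  measurable_fun setT f -> (forall x, 0 <= f x) ->
  \int[nu]_x f x = \int[mu]_x (f x * (g x)%:E).
Proof.
move=> mf f0.
have mgE : measurable_fun setT (EFin \o g) by exact/measurable_EFinP.
have indic (A : set T) : measurable A ->
    \int[nu]_x (\1_A x)%:E = \int[mu]_x ((\1_A x)%:E * (g x)%:E).
  move=> mA; rewrite integral_indic// setIT nuE// integral_mkcond.
  apply: eq_integral => x _; rewrite patchE indicE.
  by case: ifP => xA; rewrite ?mul1e ?mul0e.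
have simple (h : {nnsfun T >-> R}) :
    \int[nu]_x (h x)%:E = \int[mu]_x ((h x)%:E * (g x)%:E).
  under [LHS]eq_integral do rewrite fimfunE -fsumEFin//.
  rewrite [LHS]ge0_integral_fsum//; last 2 first.
    - by move=> r; exact/measurable_EFinP/measurableT_comp.
    - by move=> n x _; rewrite EFinM nnfun_muleindic_ge0.
  under [RHS]eq_integral.
    move=> x _; rewrite fimfunE -fsumEFin// ge0_mule_fsuml; last first.
      by move=> r; rewrite EFinM nnfun_muleindic_ge0.
    over.
  rewrite [RHS]ge0_integral_fsum//; last 2 first.
    - move=> r; apply: emeasurable_funM => //.
      by apply/measurable_EFinP; apply: measurableT_comp => //; exact: measurableT_comp.
    - move=> n x _; rewrite mule_ge0// ?lee_fin//.
      exact: nnfun_muleindic_ge0.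
  apply: eq_fsbigr => r _.
  (* A nonnegative simple function has an empty fibre over a negative level; for the other levels
     the constant can be pulled out of a nonnegative integral. *)
  have [r0|r0] := leP 0%R r; last first.
    rewrite preimage_nnfun0//.
    by rewrite !integral0_eq// => x _; rewrite indic0 mulr0 ?mul0e.
  under [RHS]eq_integral do rewrite EFinM -muleA.
  rewrite [RHS]ge0_integralZl//; last 2 first.
    - apply: emeasurable_funM => //.
      by apply/measurable_EFinP; exact: measurable_indic.
    - by move=> x _; rewrite -EFinM lee_fin mulr_ge0.
  under [LHS]eq_integral do rewrite EFinM.
  rewrite [LHS]ge0_integralZl//; last first.
    by apply/measurable_EFinP; exact: measurable_indic.
  by rewrite indic.
pose h := nnsfun_approx measurableT mf.
transitivity (limn (fun n => \int[nu]_x (h n x)%:E)).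
  rewrite -monotone_convergence//.
  - by apply: eq_integral => x _; apply/esym/cvg_lim => //; exact: cvg_nnsfun_approx.
  - by move=> n; exact/measurable_EFinP/measurable_funTS.
  - by move=> *; rewrite lee_fin.
  - by move=> x _ m n mn; rewrite lee_fin; exact/lefP/nd_nnsfun_approx.
transitivity (limn (fun n => \int[mu]_x ((h n x)%:E * (g x)%:E))).
  by congr (limn _); apply/funext => n; exact: simple.
rewrite -monotone_convergence//.
- apply: eq_integral => x _; apply/cvg_lim => //.
  by apply: cvgeZr => //; exact: cvg_nnsfun_approx.
- move=> n; apply: emeasurable_funM => //.
  exact/measurable_EFinP/measurable_funTS.
- by move=> n x _; rewrite -EFinM lee_fin mulr_ge0.
- move=> x _ m n mn; rewrite -!EFinM lee_fin ler_wpM2r//.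
  exact/lefP/nd_nnsfun_approx.
Qed.

Lemma integrable_density (f : T -> R) : measurable_fun setT f ->
  mu.-integrable setT (fun x => (f x * g x)%:E) ->
  nu.-integrable setT (EFin \o f).
Proof.
move=> mf /integrableP[_ fg]; apply/integrableP; split.
  exact/measurable_EFinP.
rewrite ge0_integral_density//; last first.
  by apply: measurableT_comp => //; exact/measurable_EFinP.
apply: le_lt_trans fg; rewrite le_eqVlt; apply/orP; left; apply/eqP.
by apply: eq_integral => x _ /=; rewrite normrM (ger0_norm (g0 x)).
Qed.

Lemma integral_density (f : T -> R) : measurable_fun setT f ->
  mu.-integrable setT (fun x => (f x * g x)%:E) ->
  \int[nu]_x (f x)%:E = \int[mu]_x (f x * g x)%:E.
Proof.
move=> mf fg; have mfE : measurable_fun setT (EFin \o f) by exact/measurable_EFinP.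
rewrite [LHS]integralE [RHS]integralE.
rewrite !ge0_integral_density//; [|exact: measurable_funeneg|exact: measurable_funepos].
congr (_ - _); apply: eq_integral => x _.
- by rewrite !funeposE EFinM -[0 in RHS](mul0e (g x)%:E) maxe_pMl// lee_fin.
- by rewrite !funenegE EFinM -mulNe -[0 in RHS](mul0e (g x)%:E) maxe_pMl// lee_fin.
Qed.

End density.

Section lebesgue_invariance.
Context (R : realType).
Notation mu := (@lebesgue_measure R).

Lemma lebesgue_measure_shift (h : R) (A : set R) : measurable A ->
  pushforward mu ((+%R^~ h) : _ -> measurableTypeR R) A = mu A.
Proof.
move=> mA; apply/esym/lebesgue_measure_unique => //=; first exact: measurable_funD.
move=> mh _ [[a b]] _ <-.
rewrite /pushforward/= [X in _ = mu X](_ : _ = `](a - h), (b - h)]%classic).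
  by rewrite !lebesgue_measure_itv/= !lte_fin ltrD2r -!EFinD opprD opprK addrACA addNr addr0.
by apply/seteqP; split => x /=; rewrite !in_itv/= ltrBlDr lerBrDr.
Qed.

Local Open Scope ereal_scope.

(** Positive and negative parts are transported separately, so that only the nonnegative change of
    variables along a pushforward enters. *)
Lemma integral_shift (f : R -> R) (h : R) : measurable_fun setT f ->
  \int[mu]_x (f (x + h)%R)%:E = \int[mu]_x (f x)%:E.
Proof.
have shift_ge0 (g : R -> \bar R) : measurable_fun setT g -> (forall x, 0 <= g x) ->
    \int[mu]_x g (x + h)%R = \int[mu]_x g x.
  move=> mg g0.
  have mh : measurable_fun setT (+%R^~ h : measurableTypeR R -> measurableTypeR R).
    exact: measurable_funD.
  transitivity (\int[pushforward mu (+%R^~ h : measurableTypeR R -> measurableTypeR R)]_x g x).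
    by rewrite ge0_integral_pushforward.
  by apply: eq_measure_integral => //= A mA AS; exact: lebesgue_measure_shift.
move=> mf; have mfE : measurable_fun setT (EFin \o f) by exact/measurable_EFinP.
rewrite integralE [RHS]integralE.
rewrite -(shift_ge0 (EFin \o f)^\+)//; last exact: measurable_funepos.
rewrite -(shift_ge0 (EFin \o f)^\-)//; last exact: measurable_funeneg.
by congr (_ - _); apply: eq_integral => x _; rewrite !(funeposE, funenegE).
Qed.

Lemma integral_oppr (f : R -> R) : measurable_fun setT f ->
  \int[mu]_x (f (- x)%R)%:E = \int[mu]_x (f x)%:E.
Proof.
have opp_ge0 (g : R -> \bar R) : measurable_fun setT g -> (forall x, 0 <= g x) ->
    \int[mu]_x g (- x)%R = \int[mu]_x g x.
  move=> mg g0.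
  transitivity (\int[pushforward mu (-%R : measurableTypeR R -> measurableTypeR R)]_x g x).
    by rewrite ge0_integral_pushforward.
  by apply: eq_measure_integral => //= A mA AS; exact: lebesgue_measureN.
move=> mf; have mfE : measurable_fun setT (EFin \o f) by exact/measurable_EFinP.
rewrite integralE [RHS]integralE.
rewrite -(opp_ge0 (EFin \o f)^\+)//; last exact: measurable_funepos.
rewrite -(opp_ge0 (EFin \o f)^\-)//; last exact: measurable_funeneg.
by congr (_ - _); apply: eq_integral => x _; rewrite !(funeposE, funenegE).
Qed.

Lemma integral_odd (f : R -> R) : mu.-integrable setT (EFin \o f) ->
  (forall x, f (- x) = - f x)%R -> \int[mu]_x (f x)%:E = 0.
Proof.
move=> fi fN; have mf : measurable_fun setT f.
  by apply/measurable_EFinP; exact: measurable_int fi.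
have fin := integrable_fin_num measurableT fi.
have : \int[mu]_x (f x)%:E = - \int[mu]_x (f x)%:E.
  rewrite -{1}(integral_oppr mf) -integralN//=; last exact: integrable_add_def.
  by apply: eq_integral => x _; rewrite fN.
move: fin => /fineK <-; rewrite -EFinN => -[] fE; congr EFin; lra.
Qed.

End lebesgue_invariance.

Section gaussian_integrability.
Context (R : realType).
Notation mu := (@lebesgue_measure R).

Lemma integrable_expR_sqr (l : R) : 0 < l ->
  mu.-integrable setT (fun x => (expR (- l * x ^+ 2))%:E).
Proof.
move=> l0; pose s : R := Num.sqrt (2 * l)^-1.
have s0 : s != 0 by rewrite gt_eqF// sqrtr_gt0 invr_gt0 mulr_gt0.
have := integrableZl measurableT (normal_peak s)^-1 (integrable_normal_pdf 0 s).
apply: eq_integrable => // x _.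
rewrite /= normal_pdfE// /= -EFinM mulKf ?gt_eqF ?normal_peak_gt0//.
rewrite /normal_fun subr0; congr (expR _)%:E.
rewrite sqr_sqrtr ?invr_ge0 ?mulr_ge0 ?ltW//; field; lra.
Qed.

(** Completing the square gives k|x| <= k^2 / (2 l) + (l / 2) x^2: half of the Gaussian decay pays
    for the linear term. *)
Lemma integrable_expR_norm_sqr (k l : R) : 0 < l ->
  mu.-integrable setT (fun x => (expR (k * `|x| - l * x ^+ 2))%:E).
Proof.
move=> l0; have l20 : 0 < l / 2 by rewrite divr_gt0.
have := integrableZl measurableT (expR (k ^+ 2 / (2 * l))) (integrable_expR_sqr l20).
apply: le_integrable => //.
  apply/measurable_EFinP; apply: measurableT_comp => //=.
  apply: measurable_funB; apply: measurable_funM => //.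
move=> x _; rewrite -EFinM !abse_EFin lee_fin -expRD !(ger0_norm (expR_ge0 _)) ler_expR.
have -> : x ^+ 2 = `|x| ^+ 2 by rewrite real_normK// num_real.
have : 0 <= (k - l * `|x|) ^+ 2 / (2 * l) by rewrite divr_ge0 ?sqr_ge0//; lra.
suff -> : (k - l * `|x|) ^+ 2 / (2 * l) = k ^+ 2 / (2 * l) - k * `|x| + l / 2 * `|x| ^+ 2 by lra.
field; lra.
Qed.

End gaussian_integrability.

(** * The weight G *)

Section reflected_weight.
Context (R : realType).
Implicit Types (b c y z : R) (k : int).

(** Evenness and the twisted oddness about [c] together force G(y) = - exp (2 b (y - c)) G(y - 2 c).
    Iterating this [k] times from the value 1 on ]-c, c[ produces the formula. *)
Definition weight_piece b c k y : R :=
  (-1) ^ k * expR (2 * b * k%:~R * (y - k%:~R * c)).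

(* The value 0 at the odd multiples of [c] makes the symmetries below hold
   everywhere, and kills the event that the boundary is first reached at [u]. *)
Definition reflected_weight b c y : R :=
  let k := Num.floor ((y + c) / (2 * c)) in
  if y + c == 2 * k%:~R * c then 0 else weight_piece b c k y.

Let piece c k y := (2 * k%:~R - 1) * c < y < (2 * k%:~R + 1) * c.

Let piece_floor c k y : 0 < c -> (2 * k%:~R - 1) * c <= y < (2 * k%:~R + 1) * c ->
  Num.floor ((y + c) / (2 * c)) = k.
Proof.
move=> c0 /andP[h1 h2]; apply: floor_def.
rewrite intrD ler_pdivlMr ?ltr_pdivrMr ?mulr_gt0//; apply/andP; split; lra.
Qed.

Lemma reflected_weightE b c k y : 0 < c -> piece c k y ->
  reflected_weight b c y = weight_piece b c k y.
Proof.
move=> c0 yk; have [h1 h2] := andP yk.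
rewrite /reflected_weight (@piece_floor c k _)// ?h2 ?ltW//.
by case: eqP => // e; lra.
Qed.

Lemma reflected_weight_boundary b c k y : 0 < c -> y = (2 * k%:~R - 1) * c ->
  reflected_weight b c y = 0.
Proof.
move=> c0 ->; rewrite /reflected_weight (@piece_floor c k _)//; last first.
  by rewrite lexx/= ltr_pM2r//; lra.
by rewrite ifT//; apply/eqP; ring.
Qed.

Lemma weight_piece_cases c y : 0 < c ->
  exists k, y = (2 * k%:~R - 1) * c \/ piece c k y.
Proof.
move=> c0; exists (Num.floor ((y + c) / (2 * c))).
have := floor_itv ((y + c) / (2 * c)); set k := Num.floor _.
rewrite intrD ler_pdivlMr ?ltr_pdivrMr ?mulr_gt0// => /andP[h1 h2].
have : (2 * k%:~R - 1) * c <= y by lra.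
rewrite le_eqVlt => /orP[/eqP <-|h]; [by left|right].
by rewrite /piece h/=; lra.
Qed.

Lemma reflected_weight1 b c y : 0 < c -> `|y| < c -> reflected_weight b c y = 1.
Proof.
move=> c0; rewrite ltr_norml => /andP[h1 h2].
rewrite (@reflected_weightE b c (0) _)// /weight_piece ?mulr0 ?mul0r ?expR0 ?mulr1//.
by apply/andP; split; lra.
Qed.

Lemma reflected_weight_edge b c y : 0 < c -> `|y| = c -> reflected_weight b c y = 0.
Proof.
move=> c0; have [y0 yc|y0 yc] := ger0P y.
- by apply: (@reflected_weight_boundary b c 1 _) => //; lra.
- by apply: (@reflected_weight_boundary b c 0 _) => //; lra.
Qed.

(** Negation sends piece [k] to piece [- k]. A boundary point is always indexed as the left end of a
    piece, and negation sends the left end of piece [k] to that of piece [1 - k]. *)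
Lemma reflected_weightN b c y : 0 < c ->
  reflected_weight b c (- y) = reflected_weight b c y.
Proof.
move=> c0; have [k [yE|yk]] := weight_piece_cases y c0.
  rewrite (reflected_weight_boundary _ c0 yE).
  by apply: (@reflected_weight_boundary b c (1 - k) _) => //; rewrite yE intrB; ring.
rewrite (reflected_weightE _ c0 yk) (@reflected_weightE b c (- k) _)//; last first.
  by move: yk => /andP[h1 h2]; rewrite /piece rmorphN/=; apply/andP; split; lra.
rewrite /weight_piece -exprz_inv invrN1 rmorphN/=.
by congr (_ * expR _); ring.
Qed.

(** The reflection y -> 2 c - y exchanges the pieces [k] and [1 - k], whose signs are opposite and
    whose exponents at c + z and c - z differ by exactly 2 b z. Left ends go from index [k] to
    [2 - k]. *)
Lemma reflected_weight_odd b c z : 0 < c ->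
  reflected_weight b c (c - z) * expR (b * z) =
  - (reflected_weight b c (c + z) * expR (- (b * z))).
Proof.
move=> c0; have [k [yE|yk]] := weight_piece_cases (c + z) c0.
  rewrite (reflected_weight_boundary _ c0 yE) mul0r oppr0.
  rewrite (@reflected_weight_boundary b c (2 - k) _) ?mul0r//.
  by rewrite intrB; lra.
rewrite (reflected_weightE _ c0 yk) (@reflected_weightE b c (1 - k) _)//; last first.
  by move: yk => /andP[h1 h2]; rewrite /piece intrB/=; apply/andP; split; lra.
rewrite /weight_piece expfzDr ?oppr_eq0 ?oner_eq0// expr1z.
rewrite -exprz_inv invrN1 mulN1r !mulNr -!mulrA -!expRD intrB.
by congr (- (_ * expR _)); ring.
Qed.

(** On piece [k] the product k (y - k c) is nonnegative, so [b] may be replaced by [be * c] in the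
    exponent; what remains is be (y - 2 k c)^2 >= 0. *)
Lemma reflected_weight_le b c be y : 0 < c -> 0 <= be -> b <= be * c ->
  `|reflected_weight b c y| <= expR (be * y ^+ 2 / 2).
Proof.
move=> c0 be0 bc; have [k [yE|yk]] := weight_piece_cases y c0.
  by rewrite (reflected_weight_boundary _ c0 yE) normr0 expR_ge0.
rewrite (reflected_weightE _ c0 yk) /weight_piece normrM expN1r normrX normrN1.
rewrite expr1n mul1r ger0_norm ?expR_ge0// ler_expR.
have kp : 0 <= k%:~R * (y - k%:~R * c).
  move: yk => /andP[h1 h2].
  have [k0|k0|->] := ltgtP k 0; last by rewrite mul0r.
  - have k1 : k%:~R <= -1 :> R by rewrite -[-1]/((-1)%:~R) ler_int -ltzD1.
    rewrite mulr_le0 ?subr_le0//; first lra.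
    nra.
  - have k1 : 1 <= k%:~R :> R by rewrite -[1]/(1%:~R) ler_int -gtz0_ge1.
    by rewrite mulr_ge0 ?subr_ge0//; nra.
have := ler_wpM2r kp bc; have : 0 <= be * (y - 2 * k%:~R * c) ^+ 2.
  by rewrite mulr_ge0// sqr_ge0.
lra.
Qed.

Lemma measurable_reflected_weight b c : 0 < c ->
  measurable_fun setT (reflected_weight b c).
Proof.
move=> c0 _ A mA; rewrite setTI.
(* Off the countable union [U] of the open pieces the weight is constantly 0. *)
pose I k := [set y : R | piece c k y]; pose U := \bigcup_k I k.
have mI k : measurable (I k).
  rewrite (_ : I k = `]((2 * k%:~R - 1) * c), ((2 * k%:~R + 1) * c)[%classic); first exact: measurable_itv.
  by apply/seteqP; split => y /=; rewrite in_itv.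
have cint : countable [set: int] by exact: countableP.
have mU : measurable U by exact: countable_bigcupT_measurable.
rewrite (_ : _ @^-1` A = \bigcup_k (I k `&` weight_piece b c k @^-1` A) `|`
   (~` U `&` (cst (0 : R)) @^-1` A)); last first.
  apply/seteqP; split => y /=.
    have [k [yE|yk]] := weight_piece_cases y c0.
      rewrite (reflected_weight_boundary _ c0 yE) => A0.
      have [yU|yU] := pselect (U y); last by right.
      left; case: yU => j _ Ij; exists j => //; split => //=.
      by rewrite -(reflected_weightE _ c0 Ij) (reflected_weight_boundary _ c0 yE).
    rewrite (reflected_weightE _ c0 yk) => Ay; left; exists k => //.
  move=> [[k _ [yk]]|[yU A0]]; first by rewrite (reflected_weightE _ c0 yk).
  have [k [yE|yk]] := weight_piece_cases y c0.
    by rewrite (reflected_weight_boundary _ c0 yE).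
  by exfalso; apply: yU; exists k.
apply: measurableU; last first.
  by apply: measurableI; [exact: measurableC|]; rewrite preimage_cst; case: ifP => _; [exact: measurableT|exact: measurable0].
apply: countable_bigcupT_measurable => // k; apply: measurableI => //.
rewrite -[X in measurable X]setTI.
suff : measurable_fun setT (weight_piece b c k) by apply.
apply: measurable_funM => //; apply: measurableT_comp => //=.
by apply: measurable_funM => //; apply: measurable_funB.
Qed.

End reflected_weight.

Section normal_sqrt.
Context (R : realType).
Notation mu := (@lebesgue_measure R).
Implicit Types (r x y z : R).

Lemma normal_pdf_sqrt r z : 0 < r ->
  normal_pdf 0 (Num.sqrt r) z = (Num.sqrt (2 * pi * r))^-1 * expR (- z ^+ 2 / (2 * r)).
Proof.
move=> r0; rewrite normal_pdfE ?gt_eqF ?sqrtr_gt0//.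
rewrite /normal_peak /normal_fun subr0 sqr_sqrtr ?ltW//.
by congr ((Num.sqrt _)^-1 * expR (_ / _)); ring.
Qed.

Lemma integral_normal_prob r (f : R -> R) : measurable_fun setT f ->
  mu.-integrable setT (fun x => (f x * normal_pdf 0 r x)%:E) ->
  (\int[normal_prob 0 r]_x (f x)%:E = \int[mu]_x (f x * normal_pdf 0 r x)%:E)%E.
Proof.
move=> mf fi; apply: integral_density => //.
- exact: measurable_normal_pdf.
- by move=> x; exact: normal_pdf_ge0.
Qed.

Lemma expR_sub1_le (s : R) : `|expR s - 1| <= `|s| * expR `|s|.
Proof.
have [s0|s0] := leP 0 s.
  rewrite !ger0_norm ?subr_ge0 -?expR0 ?ler_expR//.
  have := expR_ge1Dx (- s); rewrite expRN => h.
  have : expR s * (1 - s) <= expR s * (expR s)^-1 by rewrite ler_wpM2l ?expR_ge0.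
  by rewrite mulfV ?gt_eqF ?expR_gt0// expR0; lra.
rewrite !ltr0_norm ?subr_lt0 -?expR0 ?ltr_expR// ?expR0.
have := expR_ge1Dx s; have := expR_ge1Dx (- s); nra.
Qed.

End normal_sqrt.

Section weight_mean.
Context (R : realType) (b c u : R) (c0 : 0 < c) (u0 : 0 < u) (buc : b * u < c).
Notation mu := (@lebesgue_measure R).
Local Notation G := (reflected_weight b c).
Implicit Types (r x y z : R).

(** [be] is the quadratic growth rate of G, to be set against the Gaussian rate [u^-1]; [l] is half
    of the decay rate that is left, and [b * u < c] makes it positive. *)
Let be := Num.max b 0 / c.
Let l := (u^-1 - be) / 2.

Let be0 : 0 <= be.
Proof. by rewrite divr_ge0 ?le_max ?lexx ?orbT// ltW. Qed.

Let bbe : b <= be * c.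
Proof. by rewrite divfK ?gt_eqF// le_max lexx. Qed.

Let l0 : 0 < l.
Proof.
rewrite divr_gt0// subr_gt0 ltr_pdivrMr// mulrC ltr_pdivlMr//.
by rewrite maxEle; case: ifP; rewrite ?mul0r.
Qed.

(** Expanding (x + z)^2 in the growth bound leaves a cross term linear in |z|. A variance [r <= u]
    decays at least as fast as [u], so one [l] serves all [r]. *)
Lemma weight_pdf_le r x z : 0 < r -> r <= u ->
  `|G (x + z) * normal_pdf 0 (Num.sqrt r) z| <=
  (Num.sqrt (2 * pi * r))^-1 * expR (be * x ^+ 2 / 2) *
    expR (be * `|x| * `|z| - l * z ^+ 2).
Proof.
move=> r0 ru; rewrite normrM (ger0_norm (normal_pdf_ge0 _ _ _)) normal_pdf_sqrt//.
rewrite [leLHS]mulrCA -[leRHS]mulrA ler_wpM2l// ?invr_ge0//.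
apply: (le_trans (ler_wpM2r _ (reflected_weight_le _ c0 be0 bbe))); first exact: expR_ge0.
rewrite -!expRD ler_expR.
have h1 : - z ^+ 2 / (2 * r) <= - z ^+ 2 * u^-1 / 2.
  have -> : - z ^+ 2 / (2 * r) = - (z ^+ 2 * r^-1) / 2 by field; lra.
  have : z ^+ 2 * u^-1 <= z ^+ 2 * r^-1 by rewrite ler_wpM2l ?sqr_ge0// lef_pV2.
  lra.
have h2 : x * z <= `|x| * `|z| by rewrite -normrM ler_norm.
have := ler_wpM2l be0 h2; rewrite /l; lra.
Qed.

Lemma integrable_weight_pdf r x : 0 < r -> r <= u ->
  mu.-integrable setT (fun y => (G (x + y) * normal_pdf 0 (Num.sqrt r) y)%:E).
Proof.
move=> r0 ru.
have := integrableZl measurableT ((Num.sqrt (2 * pi * r))^-1 * expR (be * x ^+ 2 / 2))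
   (integrable_expR_norm_sqr (be * `|x|) l0).
apply: le_integrable => //.
  apply/measurable_EFinP; apply: measurable_funM; last exact: measurable_normal_pdf.
  apply: measurableT_comp; first exact: measurable_reflected_weight.
  exact: measurable_funD.
move=> z _; rewrite -EFinM !abse_EFin lee_fin (le_trans (weight_pdf_le _ _ r0 ru))//.
exact: ler_norm.
Qed.

Lemma integral_weightE r x : 0 < r -> r <= u ->
  (\int[normal_prob 0 (Num.sqrt r)]_y (G (x + y))%:E =
   \int[mu]_y (G (x + y) * normal_pdf 0 (Num.sqrt r) y)%:E)%E.
Proof.
move=> r0 ru; apply: integral_normal_prob; last exact: integrable_weight_pdf.
apply: measurableT_comp; first exact: measurable_reflected_weight.
exact: measurable_funD.
Qed.

(* Cameron-Martin: the drift [- b r] is traded for the factor [expR (- b z)],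
   which makes the weight odd about the edge, so that only the overshoot [e]
   contributes. *)
Lemma weight_mean_edge r0 : 0 < r0 -> exists2 K, 0 <= K & forall r e,
  r0 <= r -> r <= u -> `|e| <= 1 ->
  (`|\int[normal_prob 0 (Num.sqrt r)]_y (G (c - b * r + e + y))%:E| <= (K * `|e|)%:E)%E.
Proof.
(* [k] collects the linear exponents met below: [be * c] is the cross term at the edge, |b| comes
   from exp (- b z), and [1 + r0^-1] from bounding |z| exp |z e / r| with |e| <= 1. The last factor
   [r0^-1] of [C] comes from |e / r| <= |e| / r0. *)
move=> r00; pose k := be * c + `|b| + 1 + r0^-1.
pose C := (Num.sqrt (2 * pi * r0))^-1 * expR (be * c ^+ 2 / 2) / r0.
have C0 : 0 <= C.
  by rewrite /C !mulr_ge0// ?expR_ge0// ?invr_ge0 ?sqrtr_ge0 ?ltW.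
have intk := integrable_expR_norm_sqr k l0.
pose J := fine (\int[mu]_z (expR (k * `|z| - l * z ^+ 2))%:E)%E.
have JE : (\int[mu]_z (expR (k * `|z| - l * z ^+ 2))%:E = J%:E)%E.
  by rewrite fineK//; exact: integrable_fin_num.
have J0 : 0 <= J.
  by rewrite -lee_fin -JE integral_ge0// => z _; rewrite lee_fin expR_ge0.
exists (C * J); first exact: mulr_ge0.
move=> r e r0r ru e1; have rgt0 : 0 < r by exact: lt_le_trans r0r.
rewrite integral_weightE//.
pose n := normal_pdf 0 (Num.sqrt r) : R -> R.
have mG x : measurable_fun setT (fun y => G (x + y)).
  apply: measurableT_comp; first exact: measurable_reflected_weight.
  exact: measurable_funD.
have mn : measurable_fun setT n by exact: measurable_normal_pdf.
(* The substitution z = y + e - b r recentres the integral at the edge [c]. *)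
pose f z := G (c + z) * n (z + (b * r - e)).
have mf : measurable_fun setT f.
  apply: measurable_funM => //; apply: measurableT_comp => //.
  exact: measurable_funD.
have -> : (\int[mu]_y (G (c - b * r + e + y) * n y)%:E = \int[mu]_z (f z)%:E)%E.
  rewrite -(integral_shift (e - b * r) mf); apply: eq_integral => y _.
  by rewrite /f; congr (G _ * n _)%:E; lra.
pose g z := G (c + z) * expR (- (b * z)) * n z.
have mg : measurable_fun setT g.
  do 2 apply: measurable_funM => //; apply: measurableT_comp => //.
  by apply: measurableT_comp => //; exact: measurable_funM.
have g_le z : `|g z| <= C * r0 * expR ((be * c + `|b|) * `|z| - l * z ^+ 2).
  rewrite /g mulrAC normrM (ger0_norm (expR_ge0 _)).
  apply: (le_trans (ler_wpM2r (expR_ge0 _) (weight_pdf_le _ _ rgt0 ru))).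
  rewrite -[leLHS]mulrA -expRD /C divfK ?gt_eqF//.
  apply: ler_pM; rewrite ?expR_ge0// ?mulr_ge0 ?expR_ge0 ?invr_ge0 ?sqrtr_ge0//.
    rewrite ler_wpM2r ?expR_ge0// lef_pV2 ?posrE ?sqrtr_gt0 ?mulr_gt0 ?pi_gt0//.
    by rewrite ler_wsqrtr// ler_wpM2l// mulr_ge0 ?pi_ge0.
  rewrite ler_expR (gtr0_norm c0); have := ler_norm (- (b * z)).
  by rewrite normrN normrM; lra.
have gN z : g (- z) = - g z.
  have nN : n (- z) = n z by rewrite /n !normal_pdf_sqrt// sqrrN.
  by rewrite /g nN mulrN opprK reflected_weight_odd// mulNr.
have gi : mu.-integrable setT (EFin \o g).
  have := integrableZl measurableT (C * r0) (integrable_expR_norm_sqr (be * c + `|b|) l0).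
  apply: le_integrable => //; first exact/measurable_EFinP.
  move=> z _; rewrite -EFinM !abse_EFin lee_fin (le_trans (g_le z))//.
  exact: ler_norm.
(* Expanding the square gives n(z + b r - e) = E0 exp (- b z) exp (z e / r) n(z), hence f = E0 g exp
   (z e / r). Since the odd [g] has integral 0, it can be subtracted, which leaves the factor exp (z
   e / r) - 1, of order [e]. *)
pose E0 := expR (- (b * r - e) ^+ 2 / (2 * r)).
pose h z := g z * (expR (z * (e / r)) - 1).
have mh : measurable_fun setT h.
  apply: measurable_funM => //; apply: measurable_funB => //.
  by apply: measurableT_comp => //; exact: measurable_funM.
have h_le z : `|h z| <= C * `|e| * expR (k * `|z| - l * z ^+ 2).
  rewrite /h normrM.
  have : `|expR (z * (e / r)) - 1| <= `|e| / r0 * expR ((1 + r0^-1) * `|z|).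
    apply: (le_trans (expR_sub1_le _)).
    have er : `|e / r| <= `|e| / r0.
      rewrite normrM ler_wpM2l// normfV gtr0_norm// lef_pV2//.
    have ze : `|z * (e / r)| <= `|z| * (`|e| / r0) by rewrite normrM ler_wpM2l.
    have ez : expR `|z * (e / r)| <= expR (r0^-1 * `|z|).
      rewrite ler_expR (le_trans ze)// mulrC ler_wpM2r// ler_piMl// invr_ge0 ltW//.
    have zz : `|z| <= expR `|z|.
      by have := expR_ge1Dx `|z|; lra.
    apply: (le_trans (ler_pM _ _ ze ez)); rewrite ?expR_ge0//.
    rewrite -[leLHS]mulrA mulrCA ler_wpM2l ?divr_ge0 ?(ltW r00)//.
    by rewrite mulrDl mul1r expRD ler_wpM2r// expR_ge0.
  move=> h1; apply: (le_trans (ler_pM _ _ (g_le z) h1)) => //.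
  rewrite le_eqVlt; apply/orP; left; apply/eqP.
  transitivity (C * `|e| * (expR ((be * c + `|b|) * `|z| - l * z ^+ 2) * expR ((1 + r0^-1) * `|z|))).
    by field; lra.
  by rewrite -expRD; congr (_ * expR _); rewrite /k; lra.
have hi : mu.-integrable setT (EFin \o h).
  have := integrableZl measurableT (C * `|e|) intk.
  apply: le_integrable => //; first exact/measurable_EFinP.
  move=> z _; rewrite -EFinM !abse_EFin lee_fin (le_trans (h_le z))//.
  exact: ler_norm.
have -> : (\int[mu]_z (f z)%:E = E0%:E * \int[mu]_z (h z)%:E)%E.
  transitivity (E0%:E * (\int[mu]_z (h z)%:E + \int[mu]_z (g z)%:E))%E; last first.
    by rewrite (integral_odd gi gN) adde0.
  rewrite -integralD// -integralZl//; last exact: integrableD.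
  apply: eq_integral => z _; rewrite -EFinD -EFinM; congr EFin.
  rewrite /h mulrBr mulr1 subrK /f /g /n !normal_pdf_sqrt// /E0.
  transitivity (G (c + z) * (Num.sqrt (2 * pi * r))^-1 *
    (expR (- (b * r - e) ^+ 2 / (2 * r)) * expR (- (b * z)) * expR (- z ^+ 2 / (2 * r)) * expR (z * (e / r)))); last ring.
  rewrite -!expRD [LHS]mulrA; congr (_ * expR _); field; lra.
have E01 : E0 <= 1.
  by rewrite -expR0 ler_expR mulNr oppr_le0 divr_ge0 ?sqr_ge0// mulr_ge0 ?ltW.
rewrite abseM (gee0_abs (_ : 0 <= E0%:E)%E) ?lee_fin ?expR_ge0//.
apply: (@le_trans _ _ `|\int[mu]_z (h z)%:E|)%E.
  by rewrite -[leRHS]mul1e lee_wpmul2r ?abse_ge0// lee_fin.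
apply: (le_trans (le_abse_integral _ _ _)) => //; first exact/measurable_EFinP.
rewrite mulrAC EFinM -JE -integralZl//.
apply: ge0_le_integral => //.
- by apply: measurableT_comp => //; exact/measurable_EFinP.
- by apply: measurable_int (integrableZl measurableT (C * `|e|) intk).
- by move=> z _; rewrite -EFinM abse_EFin lee_fin.
Qed.

Lemma weight_meanN r x : 0 < r -> r <= u ->
  (\int[normal_prob 0 (Num.sqrt r)]_y (G (- x + y))%:E =
   \int[normal_prob 0 (Num.sqrt r)]_y (G (x + y))%:E)%E.
Proof.
move=> r0 ru; rewrite !integral_weightE// -integral_oppr; last first.
  apply: measurable_funM; last exact: measurable_normal_pdf.
  apply: measurableT_comp; first exact: measurable_reflected_weight.
  exact: measurable_funD.
apply: eq_integral => y _; rewrite -opprD reflected_weightN//.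
by rewrite !normal_pdf_sqrt// sqrrN.
Qed.

(** With r = u - t and c = a + b u, the level c - b r is the boundary a + b t at time t. Both
    boundaries are covered, by evenness. *)
Lemma weight_mean_near_edge r0 : 0 < r0 -> exists2 K, 0 <= K & forall r x e,
  r0 <= r -> r <= u -> e <= 1 -> `| `|x| - (c - b * r)| <= e ->
  (`|\int[normal_prob 0 (Num.sqrt r)]_y (G (x + y))%:E| <= (K * e)%:E)%E.
Proof.
move=> r00; have [K K0 HK] := weight_mean_edge r00; exists K => // r x e r0r ru e1 xe.
have rgt0 : 0 < r by exact: lt_le_trans r0r.
have : (`|\int[normal_prob 0 (Num.sqrt r)]_y (G (`|x| + y))%:E| <= (K * e)%:E)%E.
  have := HK r (`|x| - (c - b * r)) r0r ru (le_trans xe e1).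
  rewrite addrC subrK => /le_trans; apply.
  by rewrite lee_fin ler_wpM2l.
by have [_|_] := ger0P x; rewrite ?weight_meanN.
Qed.

End weight_mean.

Section fundamental_theorem.
Context (R : realType).
Notation mu := (@lebesgue_measure R).

(** Half-open intervals are chosen because adjacent ones glue without overlap. *)
Lemma integral_oc_is_derive (f F : R -> R) (s t : R) : s <= t ->
  (forall x, s <= x <= t -> is_derive x 1 F (f x)) ->
  (forall x, s <= x <= t -> {for x, continuous f}) ->
  (\int[mu]_(x in `]s, t]) (f x)%:E = (F t - F s)%:E)%E.
Proof.
rewrite le_eqVlt => /orP[/eqP ->|st] dF cf.
  by rewrite set_itvoc0 integral_set0 subrr.
have cF x : s <= x <= t -> {for x, continuous F}.
  move=> xst; apply: differentiable_continuous; apply/derivable1_diffP.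
  by have := dF _ xst => -[].
have wf : {within `[s, t], continuous f}.
  apply: continuous_in_subspaceT => x; rewrite inE/= in_itv/=; exact: cf.
rewrite integral_itv_obnd_cbnd; last first.
  apply/measurable_EFinP; apply: (@measurable_funS _ _ _ _ `[s, t]%classic) => //.
    exact: subset_itv_oc_cc.
  exact: subspace_continuous_measurable_fun.
rewrite (continuous_FTC2 st wf (F := F))// ?EFinB//.
- split.
  + by move=> x; rewrite in_itv/= => /andP[h1 h2]; have [] := dF x (andb_true_intro (conj (ltW h1) (ltW h2))).
  + by apply: cvg_at_right_filter; apply: cF; rewrite lexx ltW.
  + by apply: cvg_at_left_filter; apply: cF; rewrite lexx ltW.
- move=> x; rewrite in_itv/= => /andP[h1 h2]; rewrite derive1E.
  by have [_] := dF x (andb_true_intro (conj (ltW h1) (ltW h2))).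
Qed.

End fundamental_theorem.

Section Phi.
Context (R : realType).
Notation mu := (@lebesgue_measure R).
Implicit Types x y : R.

Definition std_pdf x : R := (Num.sqrt (2 * pi))^-1 * expR (- x ^+ 2 / 2).

Lemma std_pdfE x : std_pdf x = normal_pdf 0 1 x.
Proof.
rewrite normal_pdfE ?oner_eq0// /normal_peak /normal_fun subr0 /std_pdf.
by congr ((Num.sqrt _)^-1 * expR (_ / _)); ring.
Qed.

Lemma std_pdfN x : std_pdf (- x) = std_pdf x.
Proof. by rewrite /std_pdf sqrrN. Qed.

Lemma continuous_std_pdf : continuous std_pdf.
Proof.
by rewrite (funext std_pdfE); apply: continuous_normal_pdf; rewrite oner_eq0.
Qed.

Lemma is_derive_Phi x : is_derive x 1 (@Phi R) (std_pdf x).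
Proof.
have x1 : x < x + 1 by rewrite ltrDl.
have [|||d e] := @continuous_FTC1 _ std_pdf -oo%O x (x + 1) x1.
- apply: (@integrableS _ _ _ mu setT) => //.
  by rewrite (funext std_pdfE); exact: integrable_normal_pdf.
- by rewrite ltNyr.
- exact: continuous_std_pdf.
have -> : @Phi R = fun y => \int[mu]_(t in `]-oo, y]) std_pdf t by [].
by rewrite -e derive1E; apply: derivableP d.
Qed.

End Phi.

(** * The survival series *)

Section symmetric_sums.
Context (R : realType).
Implicit Types (f g : int -> R).

Lemma eq_sym_sum f g N : (forall k, f k = g k) -> sym_sum f N = sym_sum g N.
Proof. by move=> fg; apply: eq_bigr => i _; rewrite fg. Qed.

Lemma sym_sumB f g N :
  sym_sum (fun k => f k - g k) N = sym_sum f N - sym_sum g N.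
Proof. by rewrite /sym_sum sumrB. Qed.

Lemma sym_sumN f N : sym_sum (fun k => f (- k)) N = sym_sum f N.
Proof.
rewrite /sym_sum [RHS](reindex_inj rev_ord_inj)/=.
apply: eq_bigr => i _; congr f.
have e (j : nat) : (j <= N.*2)%N -> (N.*2 - j)%N%:Z = N%:Z + N%:Z - j%:Z.
  by move=> jN; rewrite -subzn// -addnn.
by rewrite subSS e -1?ltnS//; ring.
Qed.

End symmetric_sums.

Section survival_series.
Context (R : realType) (a b u : R) (a0 : 0 < a) (u0 : 0 < u) (c0 : 0 < a + b * u).
Notation mu := (@lebesgue_measure R).
Implicit Types (k : int) (x y : R).
Local Notation c := (a + b * u).
Local Notation G := (reflected_weight b c).
Local Notation n := (normal_pdf 0 (Num.sqrt u)).

Let buc : b * u < c. Proof. by rewrite ltrDr. Qed.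

(** Completing the square, 2 b k (y - k c) - y^2 / (2 u) = - (y - 2 b k u)^2 / (2 u) - 2 k^2 a b.
    The ends (2 k - 1) c and (2 k + 1) c, recentred by 2 b k u, become 2 k a - c and 2 k a + c. *)
Let piece_integral k : R :=
  (-1) ^ k * expR (- 2 * k%:~R ^+ 2 * a * b) *
  (Phi ((c + 2 * k%:~R * a) / Num.sqrt u) - Phi ((2 * k%:~R * a - c) / Num.sqrt u)).

Let edge (t : R) : R := (2 * t - 1) * c.

Let mGn (A : set R) : measurable A -> measurable_fun A (fun y => (G y * n y)%:E).
Proof.
move=> mA; apply/measurable_EFinP; apply: measurable_funTS.
apply: measurable_funM; first exact: measurable_reflected_weight.
exact: measurable_normal_pdf.
Qed.

Let pieceE k :
  (\int[mu]_(y in `]edge k%:~R, edge (k%:~R + 1)]) (G y * n y)%:E =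
   (piece_integral k)%:E)%E.
Proof.
have su0 : 0 < Num.sqrt u by rewrite sqrtr_gt0.
have su2 : Num.sqrt u ^+ 2 = u by rewrite sqr_sqrtr ?ltW.
have kc : edge k%:~R < edge (k%:~R + 1) by rewrite /edge ltr_pM2r//; lra.
pose w := (-1) ^ k * expR (- 2 * k%:~R ^+ 2 * a * b) : R.
pose F y := w * Phi ((y - 2 * b * k%:~R * u) / Num.sqrt u).
pose f y := weight_piece b c k y * n y.
have dF y : is_derive y 1 F (f y).
  have -> : f y = w *: (std_pdf ((y - 2 * b * k%:~R * u) / Num.sqrt u) * (Num.sqrt u)^-1).
    rewrite /f /weight_piece normal_pdf_sqrt// /std_pdf (sqrtrM u) ?mulr_ge0 ?pi_ge0//.
    rewrite invfM /GRing.scale/= /w -!mulrA; congr (_ * _).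
    rewrite [LHS]mulrCA [RHS]mulrCA; congr (_ * _).
    rewrite [LHS]mulrCA -expRD [RHS]mulrA -expRD [RHS]mulrC; congr (_ * expR _).
    rewrite exprMn exprVn su2; field; exact: lt0r_neq0.
  pose g y := (y - 2 * b * k%:~R * u) / Num.sqrt u.
  have dg : is_derive y 1 g (Num.sqrt u)^-1.
    have -> : g = (Num.sqrt u)^-1 \*: ((@id R) - cst (2 * b * k%:~R * u)).
      by apply/funext => z; rewrite /g mulrC.
    have := is_deriveZ (Num.sqrt u)^-1
      (is_deriveB (is_derive_id y 1) (is_derive_cst (2 * b * k%:~R * u) y 1)).
    by rewrite subr0 [_ *: _]mulr1.
  have -> : F = w \*: (@Phi R \o g) by [].
  apply: is_deriveZ; apply: is_derive1_comp; exact: is_derive_Phi.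
transitivity (\int[mu]_(y in `]edge k%:~R, edge (k%:~R + 1)[) (f y)%:E)%E.
  rewrite -integral_itv_bndo_bndc; last exact: mGn.
  apply: eq_integral => y; rewrite inE/= in_itv/= => yk.
  rewrite (reflected_weightE b c0 (k := k))//; move: yk; rewrite /edge.
  by congr (_ < _ < _); ring.
have cf : continuous f.
  move=> y; apply: cvgM; last by apply: continuous_normal_pdf; rewrite gt_eqF.
  apply: cvgM; first exact: cvg_cst.
  apply: (cvg_comp _ expR); last exact: continuous_expR.
  apply: cvgM; first exact: cvg_cst.
  by apply: cvgB; [exact: cvg_id|exact: cvg_cst].
rewrite integral_itv_bndo_bndc; last first.
  apply/measurable_EFinP/measurable_funTS; exact: continuous_measurable_fun.
rewrite (integral_oc_is_derive (F := F)) ?(ltW kc)//; last by move=> y _; exact: cf.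
have e1 : edge (k%:~R + 1) - 2 * b * k%:~R * u = c + 2 * k%:~R * a by rewrite /edge; ring.
have e2 : edge k%:~R - 2 * b * k%:~R * u = 2 * k%:~R * a - c by rewrite /edge; ring.
by rewrite /F -mulrBr /piece_integral e1 e2.
Qed.

Let integral_pieces N :
  (\int[mu]_(y in `]edge (- N%:R), edge (N%:R + 1)]) (G y * n y)%:E =
   (sym_sum piece_integral N)%:E)%E.
Proof.
have step (m : int) (p : nat) :
    (\int[mu]_(y in `]edge m%:~R, edge (m%:~R + p%:R)]) (G y * n y)%:E =
    (\sum_(i < p) piece_integral (i%:Z + m))%:E)%E.
  elim: p => [|p IH]; first by rewrite addr0 set_itvoc0 integral_set0 big_ord0.
  have le1 : edge m%:~R <= edge (m%:~R + p%:R).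
    by rewrite /edge ler_pM2r// lerD2r ler_pM2l// lerDl.
  have le2 : edge (m%:~R + p%:R) <= edge (m%:~R + p.+1%:R).
    by rewrite /edge ler_pM2r// lerD2r ler_pM2l// lerD2l ler_nat.
  rewrite (@itv_bndbnd_setU _ _ _ (BRight (edge (m%:~R + p%:R)))) ?bnd_simp//.
  rewrite integral_setU//; last 2 first.
    - exact: (mGn (measurableU _ _ _ _)).
    - apply/disj_set2P; rewrite -subset0 => y [/=]; rewrite !in_itv/= => /andP[_ h1] /andP[h2 _].
      by have := lt_le_trans h2 h1; rewrite ltxx.
  rewrite IH big_ord_recr/= EFinD; congr (_ + _)%E.
  have pm : (p%:Z + m)%:~R = m%:~R + p%:R :> R by rewrite intrD addrC.
  by rewrite -pieceE pm -[p.+1%:R]natr1 addrA.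
have := step (- N%:Z) N.*2.+1.
have -> : (- N%:Z)%:~R = - N%:R :> R by rewrite rmorphN.
have -> : - N%:R + N.*2.+1%:R = N%:R + 1 :> R by rewrite -natr1 -addnn natrD; ring.
by move=> ->.
Qed.

Lemma survival_cvg :
  (sym_sum (survival_term a b u) N)%:E @[N --> \oo] -->
  (\int[normal_prob 0 (Num.sqrt u)]_y (G y)%:E)%E.
Proof.
(* The series does not match the pieces term by term: the first [Phi] of term [k] belongs to piece
   [- k], the second one to piece [k]. Reversing only the first half repairs this, because the
   window is symmetric and the prefactor is even in [k]. *)
have sumE N : sym_sum (survival_term a b u) N = sym_sum piece_integral N.
  pose w k := (-1) ^ k * expR (- 2 * k%:~R ^+ 2 * a * b) : R.
  pose p k := w k * Phi ((a + b * u - 2 * k%:~R * a) / Num.sqrt u).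
  pose q k := w k * Phi (- ((a + b * u - 2 * k%:~R * a) / Num.sqrt u)).
  rewrite (@eq_sym_sum _ _ (fun k => p k - q k)); last first.
    by move=> k; rewrite /survival_term /p /q -mulrBr.
  rewrite sym_sumB -(sym_sumN p) -sym_sumB; apply: eq_sym_sum => k.
  have wN : w (- k) = w k by rewrite /w -exprz_inv invrN1 rmorphN/= sqrrN.
  have e1 : a + b * u - 2 * (- k)%:~R * a = c + 2 * k%:~R * a by rewrite rmorphN/=; ring.
  have e2 : - ((c - 2 * k%:~R * a) / Num.sqrt u) = (2 * k%:~R * a - c) / Num.sqrt u.
    by rewrite -[LHS]mulNr opprB.
  by rewrite /p /q wN e1 e2 -mulrBr.
have Gn := integrable_weight_pdf c0 u0 buc 0 u0 (lexx u).
have Gn' : mu.-integrable setT (fun y => (G y * n y)%:E).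
  by move: Gn; under eq_fun do rewrite add0r.
have := integral_weightE c0 u0 buc 0 u0 (lexx u).
under [X in X = _]eq_integral do rewrite add0r.
under [X in _ = X]eq_integral do rewrite add0r.
move=> ->.
(* A symmetric partial sum is the integral over the window from - (2 N + 1) c to (2 N + 1) c, which
   exhausts the line; dominated convergence applies. *)
rewrite (_ : (fun N => _) = (fun N => \int[mu]_y
   ((fun y => (G y * n y)%:E) \_ (`]edge (- N%:R), edge (N%:R + 1)]%classic)) y))%E; last first.
  by apply/funext => N; rewrite sumE -integral_pieces integral_mkcond.
apply: (@dominated_cvg _ _ _ mu setT measurableT _ _ (fun y => `|(G y * n y)%:E|%E)) => //.
- move=> N; apply/(measurable_restrictT _ _).1; [exact: measurable_itv|exact: mGn].
- move=> y _; apply: cvg_near_cst.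
  near=> N; rewrite patchE mem_set//= in_itv/=.
  have yN : `|y| / c <= N%:R by near: N; exact: nbhs_infty_ger.
  have {}yN : `|y| <= N%:R * c by rewrite -ler_pdivrMr.
  have Nc : 0 <= N%:R * c by rewrite mulr_ge0// ltW.
  have aux (t z d : R) : 0 < d -> 0 <= t * d -> `|z| <= t * d ->
      ((2 * - t - 1) * d < z) && (z <= (2 * (t + 1) - 1) * d).
    by rewrite ler_norml => d0 td /andP[h1 h2]; apply/andP; split; lra.
  exact: aux c0 Nc yN.
- exact: integrable_abse.
- by move=> N y _; rewrite patchE; case: ifP => // _; rewrite abse0.
Unshelve. all: by end_near. Qed.

End survival_series.

(** * Brownian motion and the moving boundary *)

Section independence.
Context d (Omega : measurableType d) (R : realType) (Q : probability Omega R).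
Local Open Scope ereal_scope.

Definition to_mfun d1 d2 (T1 : measurableType d1) (T2 : measurableType d2)
    (f : T1 -> T2) (mf : measurable_fun setT f) : {mfun T1 >-> T2} :=
  let m := isMeasurableFun.Build _ _ _ _ _ mf in HB.pack f m.

(** The sets satisfying the conclusion form a Dynkin system containing the pi-system [PI].
    Measurability of [S] is carried along in the same induction, since the complement and union
    steps use it. *)
Lemma independent_generated (PI : set (set Omega)) (Y : Omega -> R) :
  measurable_fun setT Y -> setI_closed PI -> PI `<=` measurable ->
  (forall E C, PI E -> measurable C -> Q (E `&` Y @^-1` C) = Q E * Q (Y @^-1` C)) ->
  forall S, <<s PI >> S -> measurable S /\
    forall C, measurable C -> Q (S `&` Y @^-1` C) = Q S * Q (Y @^-1` C).
Proof.
move=> mY PII PIm PIY.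
have mYC C : measurable C -> measurable (Y @^-1` C).
  by move=> mC; rewrite -[X in measurable X]setTI; exact: mY.
have Qfin A : measurable A -> Q A \is a fin_num.
  by move=> mA; rewrite ge0_fin_numE// (le_lt_trans (probability_le1 Q mA))// ltry.
apply: (@dynkin_induction _ (g_sigma_algebraType PI) PI) => //.
- split => // C mC; rewrite setTI probability_setT mul1e//.
- by move=> S PIS; split; [exact: PIm|move=> C mC; exact: PIY].
- move=> S _ [mS SY]; split; first exact: measurableC.
  move=> C mC; rewrite setIC -setDE measureD//; [|exact: mYC|]; last first.
    by rewrite -ge0_fin_numE//; apply: Qfin; exact: mYC.
  transitivity (Q (Y @^-1` C) - Q S * Q (Y @^-1` C)).
    by congr (_ - _); rewrite setIC; exact: SY.
  rewrite probability_setC// muleBl ?mul1e//; by apply: Qfin; exact: mYC.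
- move=> F _ tF HF; split; first by apply: bigcupT_measurable => n; have [? _] := HF n.
  move=> C mC; have mF n : d.-measurable (F n : set Omega) by have [? _] := HF n.
  rewrite setI_bigcupl !measure_bigcup//; last 2 first.
  + by move=> n _; apply: measurableI => //; exact: mYC.
  + by apply: trivIset_setIr.
  rewrite (@eq_eseriesr _ _ (fun n => Q (F n) * Q (Y @^-1` C))); last first.
    by move=> n _; have [_] := HF n; apply.
  rewrite -(fineK (Qfin _ (mYC _ mC))) muleC -nneseriesZl//.
  by apply: eq_eseriesr => n _; rewrite muleC.
Qed.

End independence.

Section freezing.
Context d (Omega : measurableType d) (R : realType) (Q : probability Omega R).
Variables (A : set Omega) (Z Y : Omega -> R) (nu : probability (measurableTypeR R) R).
Hypotheses (mA : measurable A) (mZ : measurable_fun setT Z) (mY : measurable_fun setT Y).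
Local Open Scope ereal_scope.
(** The indicator travels as a coordinate of its own: [A] may depend on more of the past than [Z],
    yet the bound on the inner integral is available only on [A]. *)
Let V (o : Omega) : R * R := (\1_A o, Z o).
Hypothesis VY : forall D C, measurable D -> measurable C ->
  Q (V @^-1` D `&` Y @^-1` C) = Q (V @^-1` D) * nu C.

Let mV : measurable_fun setT V.
Proof. by apply: measurable_fun_pair => //; exact: measurable_indic. Qed.

Let W (o : Omega) : (R * R) * measurableTypeR R := (V o, Y o).

Let mW : measurable_fun setT W.
Proof. exact: measurable_fun_pair. Qed.

Let muV : probability _ R := distribution Q (to_mfun mV).
Let muW : probability _ R := distribution Q (to_mfun mW).

Let muW_prod D : measurable D -> (muV \x nu) D = muW D.
Proof.
move=> mD; apply: product_measure_unique => // B C mB mC; exact: VY.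
Qed.

(** The joint law of [V] and [Y] agrees with the product on rectangles, hence everywhere; Fubini
    then integrates over [Y] with [Z] frozen. *)
Lemma freezing_le (G : R -> R) (K : R) : measurable_fun setT G -> (0 <= K)%R ->
  Q.-integrable setT (fun o => (G (Z o + Y o))%:E) ->
  (forall o, A o -> `|\int[nu]_y (G (Z o + y))%:E| <= K%:E) ->
  `|\int[Q]_(o in A) (G (Z o + Y o))%:E| <= K%:E * Q A.
Proof.
move=> mG K0 iG GK.
pose f (p : R * R * measurableTypeR R) := (p.1.1 * G (p.1.2 + p.2))%R.
have mf : measurable_fun setT f.
  apply: measurable_funM; first by apply: measurableT_comp.
  apply: measurableT_comp => //; apply: measurable_funD => //.
  by apply: measurableT_comp.
have mfE : measurable_fun setT (EFin \o f) by exact/measurable_EFinP.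
have fW o : f (W o) = (\1_A o * G (Z o + Y o))%R by [].
have iW : Q.-integrable setT (EFin \o f \o W).
  apply: (le_integrable _ _ _ iG) => //.
    by apply: measurableT_comp.
  move=> o _; rewrite /comp fW !abse_EFin lee_fin normrM ler_piMl//.
  by rewrite indicE; case: (_ \in _); rewrite ?normr1 ?normr0.
have -> : \int[Q]_(o in A) (G (Z o + Y o))%:E = \int[muV \x nu]_p (f p)%:E.
  transitivity (\int[muW]_p (f p)%:E); last first.
    by apply: eq_measure_integral => D mD _; apply: esym; exact: muW_prod.
  rewrite integral_distribution//= integral_mkcond; apply: eq_integral => o _.
  rewrite /= fW patchE indicE; case: ifP => _; by rewrite ?mul1r ?mul0r.
have if_ : (muV \x nu).-integrable setT (EFin \o f).
  apply/integrableP; split => //.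
  have : muW.-integrable setT (EFin \o f).
    by apply: integrable_pushforward.
  move=> /integrableP[_]; congr (_ < _).
  by apply: eq_measure_integral => D mD _; apply: esym; exact: muW_prod.
rewrite -integral12_prod_meas1//.
set F := fubini_F _ _.
have mF : measurable_fun setT F by have := measurable_fubini_F if_.
apply: (le_trans (le_abse_integral _ _ _)) => //.
rewrite ge0_integral_distribution//; last exact: measurableT_comp.
have -> : K%:E * Q A = \int[Q]_o (K * \1_A o)%:E.
  transitivity (K%:E * \int[Q]_o (\1_A o)%:E); first by rewrite integral_indic// setIT.
  rewrite -ge0_integralZl//; by apply/measurable_EFinP; exact: measurable_indic.
apply: ge0_le_integral => //.
- by move=> o _; exact: abse_ge0.
- by apply: measurableT_comp => //; exact: measurableT_comp.
- by apply/measurable_EFinP; apply: measurable_funM => //; exact: measurable_indic.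
- move=> o _; rewrite /F /fubini_F /= /f /= indicE.
  have [oA|oA] := boolP (o \in A).
    by rewrite mulr1; under eq_integral do rewrite mul1r; apply: GK; rewrite inE in oA.
  by rewrite mulr0; under eq_integral do rewrite mul0r; rewrite integral0 abse0.
Qed.

End freezing.

(** * Discretisation of continuous functions on a segment *)

Section grid.
Context (R : realType).
Implicit Types (f : R -> R) (T e t : R) (n : nat).

Definition grid T n (j : nat) : R := T * j%:R / n.+1%:R.

Lemma grid0 T n : grid T n 0 = 0. Proof. by rewrite /grid mulr0 mul0r. Qed.

Lemma grid_ge0 T n j : 0 <= T -> 0 <= grid T n j.
Proof. by move=> T0; rewrite divr_ge0// mulr_ge0. Qed.

Lemma grid_le T n j : 0 <= T -> (j <= n.+1)%N -> grid T n j <= T.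
Proof.
move=> T0 jn; rewrite ler_pdivrMr ?ltr0n// ler_wpM2l// ler_nat//.
Qed.

Lemma grid_mono T n i j : 0 <= T -> (i <= j)%N -> grid T n i <= grid T n j.
Proof. by move=> T0 ij; rewrite ler_wpM2r ?invr_ge0// ler_wpM2l// ler_nat. Qed.

Lemma grid_step T n j : grid T n j.+1 - grid T n j = T / n.+1%:R.
Proof. by rewrite /grid -mulrBl -mulrBr -natr1 addrAC subrr add0r mulr1. Qed.

Lemma grid_near T n t : 0 <= t <= T ->
  exists2 j, (j <= n.+1)%N & `|t - grid T n j| <= T / n.+1%:R.
Proof.
move=> /andP[t0 tT]; have [T0|T0] := leP T 0.
  exists 0%N => //; rewrite grid0 subr0 ger0_norm//.
  have -> : t = 0 by lra.
  by rewrite divr_ge0//; lra.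
have n0 : 0 < n.+1%:R :> R by rewrite ltr0n.
pose j := Num.truncn (t * n.+1%:R / T).
have tn0 : 0 <= t * n.+1%:R / T by rewrite divr_ge0 ?mulr_ge0// ltW.
have := truncn_itv tn0; rewrite -/j ler_pdivlMr// ltr_pdivrMr// => /andP[h1 h2].
exists j.
  rewrite -(ler_nat R) -(ler_pM2r T0) (le_trans h1)// mulrC ler_wpM2l// ltW//.
rewrite ger0_norm; last by rewrite subr_ge0 /grid ler_pdivrMr// mulrC.
rewrite lerBlDr -mulrDl ler_pdivlMr// ltW// (lt_le_trans h2)//.
by rewrite -natr1 mulrDl mul1r mulrC addrC.
Qed.

(** Uniform continuity on the segment, obtained from a near covering: a local radius [d] is halved
    between the move to the neighbour [x'] and the mesh. *)
Lemma unif_step f T e : continuous f -> 0 < e ->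
  \forall n \near \oo, forall x y, 0 <= x <= T -> `|x - y| <= T / n.+1%:R ->
  `|f x - f y| <= e.
Proof.
move=> cf e0; have [T0|T0] := ltP T 0.
  by near=> n => x y /andP[h1 h2]; have := le_lt_trans (le_trans h1 h2) T0; rewrite ltxx.
pose P n x := forall y, `|x - y| <= T / n.+1%:R -> `|f x - f y| <= e.
suff : \forall n \near \oo, `[0, T]%classic `<=` P n.
  by apply: filterS => n H x y xT; apply: H; rewrite /= in_itv.
have /compact_near_coveringP := @segment_compact R 0 T; apply => x _.
have [d d0 Hd] : exists2 d : R, 0 < d & forall z, `|x - z| < d -> `|f x - f z| < e / 2.
  have /cvgrPdist_lt /(_ (e / 2)) := cf x; rewrite divr_gt0// => /(_ isT).
  by move=> /nbhs_ballP[d /= d0 Hd]; exists d.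
have d20 : 0 < d / 2 by rewrite divr_gt0.
near=> x' n => /= y x'y.
have xx' : `|x - x'| < d / 2.
  near: x'; apply/nbhs_ballP; exists (d / 2) => //.
have Tn : T / n.+1%:R < d / 2.
  rewrite ltr_pdivrMr// mulrC -ltr_pdivrMr//.
  have : T / (d / 2) <= n%:R by near: n; exact: nbhs_infty_ger.
  by move=> /le_lt_trans; apply; rewrite ltr_nat.
have dd : d / 2 < d by lra.
have h1 : `|f x - f x'| < e / 2 by apply: Hd; exact: lt_trans xx' dd.
have h2 : `|f x - f y| < e / 2.
  apply: Hd; apply: (le_lt_trans (ler_distD x' x y)).
  by rewrite [d]splitr ltr_leD// (le_trans x'y)// ltW.
apply: (le_trans (ler_distD (f x) (f x') (f y))); rewrite (distrC (f x')).
by rewrite [e]splitr lerD// ltW.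
Unshelve. all: by end_near. Qed.

Lemma grid_approach f T e : continuous f ->
  (exists2 t, 0 <= t <= T & - e < f t) ->
  \forall n \near \oo, exists2 j, (j <= n.+1)%N & - e < f (grid T n j).
Proof.
move=> cf [t tT ft]; have e0 : 0 < (f t + e) / 2 by lra.
have := unif_step T cf e0; apply: filterS => n H.
have [j jn tj] := grid_near n tT; exists j => //.
have := H _ _ tT tj; rewrite ler_norml => /andP[h1 h2]; lra.
Qed.

(** The cap [<= e] keeps the path in the layer where the edge estimate holds, and being first makes
    the events for different [j] disjoint. *)
Definition grid_crossing f T n e (j : nat) :=
  (forall i, (i < j)%N -> f (grid T n i) <= - e) /\ - e < f (grid T n j) <= e.

(** For each path the cap is automatic on fine grids: just before the first entry the value is at
    most [- e], and one step changes it by at most [e]. The start [f 0 <= - e] guarantees that there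
    is a previous grid point. *)
Lemma grid_crossing_near f T e : continuous f -> 0 <= T -> 0 < e -> f 0 <= - e ->
  \forall n \near \oo, (exists2 j, (j <= n.+1)%N & grid_crossing f T n e j) <->
     (exists2 t, 0 <= t <= T & - e < f t).
Proof.
move=> cf T0 e0 f0; have [h|h] := pselect (exists2 t, 0 <= t <= T & - e < f t); last first.
  near=> n; split => // -[j jn [_ /andP[fj _]]]; exfalso; apply: h.
  by exists (grid T n j); rewrite ?grid_ge0 ?grid_le.
have H1 := grid_approach cf h; have H2 := unif_step T cf e0.
near=> n; split => // _.
have ex : exists j, (j <= n.+1)%N && (- e < f (grid T n j)).
  have : exists2 j, (j <= n.+1)%N & - e < f (grid T n j) by near: n.
  by move=> [j jn fj]; exists j; rewrite jn.
case: (ex_minnP ex) => j /andP[jn fj] jmin.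
exists j => //; split.
  move=> i ij; rewrite leNgt; apply/negP => fi.
  have := jmin i; rewrite fi (leq_trans (ltnW ij) jn) => /(_ isT).
  by rewrite leqNgt ij.
rewrite fj/=; case: j jn fj jmin => [|j] jn fj jmin; first by rewrite grid0; lra.
have fj1 : f (grid T n j) <= - e.
  rewrite leNgt; apply/negP => fi.
  by have := jmin j; rewrite fi (ltnW jn) => /(_ isT); rewrite ltnn.
have U : forall x y, 0 <= x <= T -> `|x - y| <= T / n.+1%:R -> `|f x - f y| <= e.
  by near: n.
have := U (grid T n j) (grid T n j.+1).
rewrite grid_ge0// grid_le ?(ltnW jn)// distrC grid_step ger0_norm ?divr_ge0//.
move=> /(_ isT (lexx _)); rewrite ler_norml => /andP[h1 h2]; lra.
Unshelve. all: by end_near. Qed.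

Lemma ge0_attained f T : continuous f -> 0 <= T ->
  (forall m : nat, exists2 t, 0 <= t <= T & - m.+1%:R^-1 < f t) ->
  exists2 t, 0 <= t <= T & 0 <= f t.
Proof.
move=> cf T0 H.
have [c cT cmax] := EVT_max T0 (continuous_subspaceT cf).
exists c; first by rewrite in_itv in cT.
rewrite leNgt; apply/negP => fc.
have [m mfc] := ltr_add_invr fc.
have [t tT ft] := H m; have := cmax t; rewrite in_itv/= tT => /(_ isT); move: (m.+1%:R^-1) ft mfc => z; lra.
Qed.

End grid.

(** * Paths on the real line and their hitting times *)

Section path_fun.
Context (R : realType).
Implicit Types (w : cts_path R) (r t u a b : R).

Lemma time_ofE r : 0 <= r -> time_val (time_of r) = r.
Proof.
move=> r0; rewrite /time_of /time_val.
have -> : set_val (insubd (time0 R) r) = \val (insubd (time0 R) r) by [].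
by rewrite val_insubd mem_set//= in_itv/= r0.
Qed.

Lemma time_of_val (t : half_line R) : time_of (time_val t) = t.
Proof. by rewrite /time_of /time_val; exact: valKd. Qed.

Lemma time_val_ge0 (t : half_line R) : 0 <= time_val t.
Proof. by have := set_valP t; rewrite /= in_itv/= andbT. Qed.

Definition path_fun w r : R := w (time_of r).

Lemma path_fun_continuous w : continuous (path_fun w).
Proof.
have ctime : continuous (@time_of R : R -> half_line R).
  apply: continuous_comp_initial.
  (* The default time 0 makes [time_of] the retraction of the line onto the half-line, so a path
     extends to a continuous function on all of [R]. *)
  have -> : (set_val \o @time_of R) = (fun r => Num.max 0 r).
    apply/funext => s; rewrite /= /time_of.
    have -> : set_val (insubd (time0 R) s) = \val (insubd (time0 R) s) by [].
    rewrite val_insubd; have [s0|s0] := leP 0 s.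
      by rewrite mem_set//= in_itv/= s0.
    by rewrite memNset//= in_itv/= leNgt s0.
  by move=> r; apply: continuous_max; [exact: cst_continuous|exact: cvg_id].
move=> r; apply: continuous_comp; first exact: ctime.
exact: (@cts_fun _ _ w).
Qed.

Definition gap a b w t : R := path_fun w t - (a + b * t).

Lemma gap_continuous a b w : continuous (gap a b w).
Proof.
move=> t; apply: cvgB; first exact: path_fun_continuous.
apply: cvgD; first exact: cvg_cst.
by apply: cvgM; [exact: cvg_cst|exact: cvg_id].
Qed.

Lemma hitting_time_ge0 a b w : (0 <= hitting_time a b w)%E.
Proof.
by apply: le_ereal_inf_tmp => _ [t _ <-]; rewrite lee_fin time_val_ge0.
Qed.

(** A gap that is nonzero at [u] stays so a little to the right of [u]; this makes the infimum
    strictly larger than [u]. *)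
Lemma lt_hitting_time a b w u :
  (u%:E < hitting_time a b w)%E <-> (forall t, 0 <= t <= u -> gap a b w t != 0).
Proof.
split=> [uH t /andP[t0 tu]|H].
  apply/eqP => gt; have : (hitting_time a b w <= t%:E)%E.
    apply: ereal_inf_lbound; exists (time_of t); last by rewrite time_ofE.
    by rewrite /= time_ofE//; move: gt; rewrite /gap /path_fun => /eqP; rewrite subr_eq0 => /eqP.
  by move=> /(lt_le_trans uH); rewrite lte_fin ltNge tu.
have [u0|u0] := ltP u 0; first by apply: lt_le_trans (hitting_time_ge0 a b w).
have [d d0 Hd] : exists2 d : R, 0 < d & forall t, `|u - t| < d -> gap a b w t != 0.
  have gu : 0 < `|gap a b w u| by rewrite normr_gt0 H// u0 lexx.
  have /cvgrPdist_lt /(_ _ gu) := @gap_continuous a b w u.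
  move=> /nbhs_ballP[d /= d0 Hd]; exists d => // t ut; apply/eqP => gt0.
  by have := Hd t ut; rewrite gt0 subr0 ltxx.
apply: (@lt_le_trans _ _ (u + d)%:E); first by rewrite lte_fin ltrDl.
apply: le_ereal_inf_tmp => _ [t wt <-]; rewrite lee_fin leNgt; apply/negP => tud.
have gt0 : gap a b w (time_val t) = 0 by rewrite /gap /path_fun time_of_val wt subrr.
have [tu|ut] := leP (time_val t) u.
  by have := H (time_val t); rewrite time_val_ge0 tu gt0 eqxx => /(_ isT).
have utd : `|u - time_val t| < d by rewrite ltr0_norm ?subr_lt0//; lra.
by have := Hd _ utd; rewrite gt0 eqxx.
Qed.

Lemma hitting_time_attained a b w r : hitting_time a b w = r%:E ->
  0 <= r /\ path_fun w r = a + b * r.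
Proof.
move=> Hr; have r0 : 0 <= r by rewrite -lee_fin -Hr hitting_time_ge0.
split => //; apply/eqP; rewrite -subr_eq0 -/(gap a b w r); apply: contraT => gr.
have : (r%:E < hitting_time a b w)%E.
  apply/lt_hitting_time => t /andP[t0 tr].
  have [tr'|tr'|->//] := ltgtP t r; last by move: tr; rewrite leNgt tr'.
  have : (t%:E < hitting_time a b w)%E by rewrite Hr lte_fin.
  by move=> /lt_hitting_time/(_ t); rewrite t0 lexx; apply.
by rewrite Hr ltxx.
Qed.

Lemma gap_neq0 a b w u : 0 <= u -> (forall t, 0 <= t <= u -> gap a b w t != 0) <->
  (forall t, 0 <= t <= u -> gap a b w t < 0) \/ (forall t, 0 <= t <= u -> 0 < gap a b w t).
Proof.
move=> u0; split=> [H|[H|H] t /H]; [|by move/lt_eqF/negbT|by move/gt_eqF/negbT].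
have H0 : gap a b w 0 != 0 by apply: H; rewrite lexx.
have cross t : 0 <= t <= u -> Num.min (gap a b w 0) (gap a b w t) <= 0 <= Num.max (gap a b w 0) (gap a b w t) -> False.
  move=> /andP[t0 tu] h.
  have [c] := IVT t0 (continuous_subspaceT (@gap_continuous a b w)) h.
  rewrite in_itv/= => /andP[c0 ct] gc.
  by have := H c; rewrite c0 (le_trans ct tu) gc eqxx => /(_ isT).
have [g0|g0|g0] := ltgtP (gap a b w 0) 0; [left|right|by rewrite g0 eqxx in H0] => t tu.
- rewrite ltNge; apply/negP => gt; apply: (cross t tu).
  by rewrite ge_min le_max (ltW g0) gt orbT.
- rewrite ltNge; apply/negP => gt; apply: (cross t tu).
  by rewrite ge_min le_max (ltW g0) gt orbT.
Qed.

End path_fun.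

Section crossing_measurable.
Context d (T : measurableType d) (R : realType) (X : T -> R -> R) (u : R).
Hypotheses (cX : forall o, continuous (X o)) (u0 : 0 <= u).
Hypothesis mX : forall t, 0 <= t -> measurable_fun setT (X^~ t).

(** A strict inequality at some time persists at a point of a fine enough grid, so the event is a
    countable union. The non-strict version that follows is the intersection over 1 / (m + 1), by
    attainment of the maximum. *)
Lemma measurable_exceeds e :
  measurable [set o | exists2 t, 0 <= t <= u & - e < X o t].
Proof.
have mE n j : measurable [set o | - e < X o (grid u n j)].
  rewrite -[X in measurable X]setTI.
  have := mX (grid_ge0 n j u0) measurableT (measurable_itv `]- e, +oo[).
  by congr (measurable (_ `&` _)); apply/seteqP; split => o /=; rewrite in_itv/= andbT.
rewrite (_ : [set _ | _] = \bigcup_n \bigcup_(j in [set j | (j <= n.+1)%N])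
   [set o | - e < X o (grid u n j)]).
  by apply: bigcup_measurable => n _; apply: bigcup_measurable => j _; exact: mE.
apply/seteqP; split => o /=.
  move=> /(grid_approach (@cX o))[n _ /(_ n)/(_ (leqnn n))[j jn h]].
  by exists n => //; exists j.
by move=> [n _ [j /= jn h]]; exists (grid u n j) => //; rewrite grid_ge0// grid_le.
Qed.

Lemma measurable_crosses : measurable [set o | exists2 t, 0 <= t <= u & 0 <= X o t].
Proof.
rewrite (_ : [set _ | _] = \bigcap_m [set o | exists2 t, 0 <= t <= u & - m.+1%:R^-1 < X o t]).
  by apply: bigcap_measurable => // m _; exact: measurable_exceeds.
apply/seteqP; split => o /=.
  move=> [t tu Xt] m _ /=; exists t => //; apply: lt_le_trans Xt.
  by rewrite oppr_lt0 invr_gt0.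
by move=> H; apply: (ge0_attained (@cX o)) => // m; exact: H.
Qed.

End crossing_measurable.

Section hitting_measurable.
Context (R : realType).

Lemma measurable_path_eval (t : half_line R) :
  measurable_fun setT (fun w : path_space R => (w : cts_path R) t).
Proof.
move=> _ A mA; rewrite setTI; apply: sub_sigma_algebra; by exists t; exists A.
Qed.

Lemma measurable_gap a b (t : R) :
  measurable_fun setT (fun w : path_space R => gap a b w t).
Proof. apply: measurable_funB => //; exact: measurable_path_eval. Qed.

Lemma measurable_hitting_time a b :
  measurable_fun setT (hitting_time a b : path_space R -> \bar R).
Proof.
apply: (measurability _ (ErealGenOInfty.measurableE R)) => _ [_ [u ->] <-].
rewrite setTI [X in measurable X](_ : _ = [set w | (u%:E < hitting_time a b w)%E]); last first.
  by apply/seteqP; split => w /=; rewrite in_itv/= andbT.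
have [u0|u0] := ltP u 0.
  rewrite [X in measurable X](_ : _ = setT)//; apply/seteqP; split => w // _ /=.
  by apply: lt_le_trans (hitting_time_ge0 a b w).
have cN (w : path_space R) : continuous (fun t => - gap a b w t).
  by move=> t; apply: cvgN; exact: gap_continuous.
(* By the intermediate value theorem a gap without zeros has a constant sign, which gives two
   no-crossing events. *)
rewrite [X in measurable X](_ : _ =
    ~` [set w | exists2 t, 0 <= t <= u & 0 <= gap a b w t] `|`
    ~` [set w | exists2 t, 0 <= t <= u & 0 <= - gap a b w t]).
  apply: measurableU; apply: measurableC; apply: measurable_crosses => //.
  - by move=> w; exact: gap_continuous.
  - by move=> t _; exact: measurable_gap.
  - by move=> t _; apply: measurable_funN; exact: measurable_gap.
apply/seteqP; split => w /=.
  move=> /lt_hitting_time/gap_neq0 -/(_ u0)[H|H]; [left|right] => -[t /H];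
  by rewrite ?oppr_ge0 leNgt => ->.
move=> H; apply/lt_hitting_time/gap_neq0 => //.
by case: H => H; [left|right] => t tu; rewrite ltNge; apply/negP => h; apply: H; exists t => //; rewrite oppr_ge0.
Qed.

End hitting_measurable.

Section set_limits.
Context d (T : measurableType d) (R : realType) (mu : {measure set T -> \bar R}).
Local Open Scope ereal_scope.

(** Dominated convergence. The alternative [h o = 0] is meant for paths that touch the boundary
    first at time [u]: there the sets do not converge, but the weight vanishes. *)
Lemma set_limit_integral_le (h : T -> R) (D_ : (set T)^nat) (D : set T) (M : \bar R) :
  mu.-integrable setT (EFin \o h) ->
  (forall n, measurable (D_ n)) -> measurable D ->
  (forall o, h o = 0%R \/ \forall n \near \oo, D_ n o <-> D o) ->
  (\forall n \near \oo, `|\int[mu]_(o in D_ n) (h o)%:E| <= M) ->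
  `|\int[mu]_(o in D) (h o)%:E| <= M.
Proof.
move=> hi mD_ mD DD leM.
have mh : measurable_fun setT (EFin \o h) by exact: measurable_int hi.
have : \int[mu]_(o in D_ n) (h o)%:E @[n --> \oo] --> \int[mu]_(o in D) (h o)%:E.
  rewrite integral_mkcond.
  under eq_fun do rewrite integral_mkcond.
  apply: (@dominated_cvg _ _ _ mu setT measurableT _ _ (fun o => `|(h o)%:E|)) => //.
  - by move=> n; apply/(measurable_restrictT _ _).1 => //; apply: measurable_funTS.
  - move=> o _; apply: cvg_near_cst; rewrite /patch.
    have [->|H] := DD o; first by near=> n; case: ifP; case: ifP.
    near=> n; have [H1 H2] : D_ n o <-> D o by near: n.
    congr (if _ then _ else _); apply/idP/idP; rewrite !inE; [exact: H1|exact: H2].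
  - exact: integrable_abse.
  - by move=> n o _; rewrite patchE; case: ifP => // _; rewrite abse0.
by move=> /cvg_abse; exact: cvge_le.
Unshelve. all: by end_near. Qed.

End set_limits.

(** The measurable space is arbitrary so that the sigma-algebra of the past can be put in its
    place. *)
Lemma measurable_first_entry d (T : measurableType d) (R : realType) (X : nat -> T -> R)
  (j : nat) (e : R) : (forall i, (i <= j)%N -> measurable_fun setT (X i)) ->
  measurable [set o | (forall i, (i < j)%N -> X i o <= - e) /\ - e < X j o <= e].
Proof.
move=> mX.
rewrite (_ : [set _ | _] = (\bigcap_(i < j) (X i @^-1` `]-oo, - e])) `&` (X j @^-1` `]- e, e])).
  apply: measurableI.
    apply: bigcap_measurableType => i /= ij; rewrite -[X in measurable X]setTI.
    by apply: mX => //; exact: ltnW.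
  by rewrite -[X in measurable X]setTI; exact: mX.
apply/seteqP; split => o /=.
  move=> [H1 H2]; split; last by rewrite in_itv.
  by move=> i /= ij; rewrite in_itv/=; exact: H1.
move=> [H1]; rewrite in_itv/= => H2; split => //.
Qed.

(** * Non-crossing probability of Brownian motion *)

Section brownian.
Context (R : realType) d (Omega : measurableType d) (Q : probability Omega R).
Variables (B : {RV Q >-> path_space R}) (hB : standard_brownian_motion B).
Implicit Types (s t r : R) (o : Omega).

Definition bm o t : R := path_fun (B o) t.

Lemma measurable_bm t : measurable_fun setT (bm^~ t).
Proof. by apply: (measurableT_comp (measurable_path_eval _)). Qed.

Lemma bm0 o : bm o 0 = 0.
Proof.
have [B0 _ _] := hB; rewrite -[RHS](B0 o) /bm /path_fun; congr ((B o : cts_path R) _).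
by rewrite -[LHS]/(time_of (time_val (time0 R))) time_of_val.
Qed.

Lemma bm_law s t (A : set R) : 0 <= s -> s < t -> measurable A ->
  Q [set o | A (bm o t - bm o s)] = normal_prob 0 (Num.sqrt (t - s)) A.
Proof.
move=> s0 st mA; have [_ _ H] := hB.
have t0 : 0 <= t by rewrite (le_trans s0)// ltW.
by have := H (time_of s) (time_of t) A; rewrite !time_ofE//; apply.
Qed.

Section one_crossing_time.
Variables (T u : R) (n j : nat) (T0 : 0 <= T) (Tu : T < u) (jn : (j <= n.+1)%N).
Let g := grid T n.

Let incr i o := bm o (g i.+1) - bm o (g i).
Let cyl (D : nat -> set R) := \bigcap_(i < j) [set o | D i (incr i o)].
(** Cylinders over increments rather than positions, since independence is given for increments.
    Positions are recovered from them by summation, the start being 0. *)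
Let past : set (set Omega) :=
  [set E | exists2 D : nat -> set R, (forall i, measurable (D i)) & E = cyl D].

Let g0 i : 0 <= g i. Proof. exact: grid_ge0. Qed.
Let gT : g j <= T. Proof. exact: grid_le. Qed.
Let gu : g j < u. Proof. exact: le_lt_trans Tu. Qed.

Let mincr i (D : set R) : measurable D -> measurable [set o | D (incr i o)].
Proof.
move=> mD; rewrite -[X in measurable X]setTI.
have : measurable_fun setT (incr i) by apply: measurable_funB; exact: measurable_bm.
exact.
Qed.

Let Y o := bm o u - bm o (g j).

(* Constant times after [j] make [Y] the increment with index [j]. *)
Let past_indep E C : past E -> measurable C ->
  Q (E `&` Y @^-1` C) = (Q E * Q (Y @^-1` C))%E.
Proof.
move=> [D mD ->] mC; have [_ H _] := hB.
pose tt i : R := if (i <= j)%N then g i else u.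
have tt0 i : 0 <= tt i.
  by rewrite /tt; case: ifP => // _; rewrite (le_trans T0)// ltW.
pose t_ i := time_of (tt i).
pose A_ i := if (i < j)%N then D i else C.
have t_mono i : t_ i <= t_ i.+1 :> R.
  rewrite !time_ofE// /tt; have [ij|ij] := leqP i j; last first.
    by rewrite leqNgt (leqW ij).
  case: ifP => ij1; first exact: grid_mono.
  by rewrite ltW// (le_lt_trans _ gu)// grid_mono.
have mA_ i : measurable (A_ i) by rewrite /A_; case: ifP.
have incrE i : (i < j)%N -> [set o | A_ i (increment (t_ i) (t_ i.+1) (B o))] = [set o | D i (incr i o)].
  by move=> ij; rewrite /A_ /t_ /tt ij ltnW.
have incrj : [set o | A_ j (increment (t_ j) (t_ j.+1) (B o))] = Y @^-1` C.
  by rewrite /A_ /t_ /tt ltnn leqnn.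
have cylE : cyl D = \bigcap_(i < j) [set o | A_ i (increment (t_ i) (t_ i.+1) (B o))].
  by apply: eq_bigcapr => i /= ij; rewrite incrE.
have := H j.+1 t_ A_ t_mono mA_.
rewrite (bigop.big_ord_recr j)/= incrj -(H j t_ A_ t_mono mA_) -cylE => <-.
congr (Q _); rewrite cylE -incrj; apply/seteqP; split => o.
  by move=> [H1 H2] i /=; rewrite ltnS leq_eqVlt => /orP[/eqP ->//|]; exact: H1.
by move=> H1; split => [i /= ij|]; apply: H1 => //=; exact: ltnW.
Qed.

Let incr_past i : (i < j)%N ->
  measurable_fun setT (incr i : g_sigma_algebraType past -> R).
Proof.
move=> ij _ A mA; rewrite setTI; apply: sub_sigma_algebra.
exists (fun k => if k == i then A else setT); first by move=> k; case: ifP.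
apply/seteqP; split => o /=.
  by move=> Ao k /= kj; case: ifPn => // /eqP ->.
by move=> /(_ i ij) /=; rewrite eqxx.
Qed.

Let bm_past i : (i <= j)%N ->
  measurable_fun setT ((fun o => bm o (g i)) : g_sigma_algebraType past -> R).
Proof.
elim: i => [_|i IH ij].
  rewrite (_ : (fun o => _) = cst 0); first exact: measurable_cst.
  by apply/funext => o; rewrite /g grid0 bm0.
rewrite (_ : (fun o => _) = (fun o => bm o (g i) + incr i o)); last first.
  by apply/funext => o; rewrite /incr addrC subrK.
by apply: measurable_funD; [exact: IH (ltnW ij)|exact: incr_past].
Qed.

Let pastI : setI_closed past.
Proof.
move=> _ _ [D mD ->] [D' mD' ->]; exists (fun i => D i `&` D' i).
  by move=> i; exact: measurableI.
rewrite /cyl -bigcapI; apply: eq_bigcapr => i _; by apply/seteqP; split.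
Qed.

Let past_measurable : past `<=` measurable.
Proof.
move=> _ [D mD ->]; apply: bigcap_measurableType => i _; exact: mincr.
Qed.

Let mY : measurable_fun setT Y.
Proof. by apply: measurable_funB; exact: measurable_bm. Qed.

(** The Markov property at the deterministic time [g j]: the crossing event and the position lie in
    the past, and the increment up to [u] is independent of it, with law N(0, u - g j). *)
Lemma grid_crossing_integral_le (a b e M : R) (G : R -> R) :
  measurable_fun setT G -> 0 <= M ->
  Q.-integrable setT (fun o => (G (bm o u))%:E) ->
  (forall x, `| `|x| - (a + b * g j)| <= e ->
    (`|\int[normal_prob 0 (Num.sqrt (u - g j))]_y (G (x + y))%:E| <= M%:E)%E) ->
  let A := [set o | grid_crossing (fun t => `|bm o t| - (a + b * t)) T n e j] in
  measurable A /\ (`|\int[Q]_(o in A) (G (bm o u))%:E| <= M%:E * Q A)%E.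
Proof.
move=> mG M0 iG GM A.
have pA : <<s past >> A.
  pose X i o := `|bm o (g i)| - (a + b * g i).
  have mX i : (i <= j)%N -> measurable_fun setT (X i : g_sigma_algebraType past -> R).
    by move=> ij; apply: measurable_funB => //; apply: measurableT_comp => //; exact: bm_past.
  exact: (measurable_first_entry e mX).
have indep := independent_generated mY pastI past_measurable past_indep.
have mA : measurable A by have [] := indep A pA.
split => //; pose Z o := bm o (g j).
have mZ : measurable_fun setT Z by exact: measurable_bm.
have ZY o : bm o u = Z o + Y o by rewrite /Z /Y addrC subrK.
under eq_integral do rewrite ZY.
have iG' : Q.-integrable setT (fun o => (G (Z o + Y o))%:E).
  by move: iG; congr (integrable _ _ _); apply/funext => o; rewrite ZY.
apply: (freezing_le (nu := normal_prob 0 (Num.sqrt (u - g j))) mA mZ mY _ mG M0 iG').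
- move=> D C mD mC.
  have mV : measurable_fun setT ((fun o => (\1_A o : R, Z o)) : g_sigma_algebraType past -> R * R).
    by apply: measurable_fun_pair; [exact: measurable_indic|exact: bm_past].
  have [_ /(_ C mC)] := indep _ (mV measurableT D mD); rewrite !setTI => VY.
  by apply: (etrans VY); congr (_ * _)%E; exact: bm_law.
- move=> o [_ /andP[h1 h2]]; apply: GM; rewrite ler_norml; apply/andP; split => //; exact: ltW.
Qed.

End one_crossing_time.

Section crossing.
Variables (a b u : R) (a0 : 0 < a) (u0 : 0 < u) (c0 : 0 < a + b * u).
Local Notation c := (a + b * u).
Local Notation G := (reflected_weight b c).

Definition excess o t := `|bm o t| - (a + b * t).

Let buc : b * u < c. Proof. by rewrite ltrDr. Qed.

Let mG : measurable_fun setT G. Proof. exact: measurable_reflected_weight. Qed.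

Lemma excess_continuous o : continuous (excess o).
Proof.
move=> t; apply: cvgB; first by apply: cvg_norm; exact: path_fun_continuous.
apply: cvgD; first exact: cvg_cst.
by apply: cvgM; [exact: cvg_cst|exact: cvg_id].
Qed.

Lemma excess0 o : excess o 0 = - a.
Proof. by rewrite /excess bm0 normr0; lra. Qed.

Let mexcess t : measurable_fun setT (excess^~ t).
Proof.
apply: measurable_funB => //; apply: measurableT_comp => //; exact: measurable_bm.
Qed.

Let bm_u_law (A : set R) : measurable A ->
  Q [set o | A (bm o u)] = normal_prob 0 (Num.sqrt u) A.
Proof.
move=> mA; rewrite -{2}[u]subr0 -(bm_law (lexx 0) u0 mA).
by congr (Q _); apply/seteqP; split => o /=; rewrite bm0 subr0.
Qed.

Lemma integral_bm (f : R -> \bar R) : measurable_fun setT f -> (forall y, 0 <= f y)%E ->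
  (\int[Q]_o f (bm o u) = \int[normal_prob 0 (Num.sqrt u)]_y f y)%E.
Proof.
move=> mf f0; rewrite -(ge0_integral_distribution (@to_mfun _ _ Omega (measurableTypeR R) _ (measurable_bm u)))//.
by apply: eq_measure_integral => A mA _; exact: bm_u_law.
Qed.

Let iGn : (normal_prob 0 (Num.sqrt u)).-integrable setT (EFin \o G).
Proof.
apply: (@integrable_density _ _ _ lebesgue_measure _ (normal_pdf 0 (Num.sqrt u))) => //.
- exact: measurable_normal_pdf.
- by move=> x; exact: normal_pdf_ge0.
have := integrable_weight_pdf c0 u0 buc 0 u0 (lexx u).
by congr (integrable _ _ _); apply/funext => y; rewrite add0r.
Qed.

Let iG : Q.-integrable setT (fun o => (G (bm o u))%:E).
Proof.
apply/integrableP; split.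
  apply/measurable_EFinP; apply: measurableT_comp => //; exact: measurable_bm.
rewrite (@integral_bm (fun y => `|(G y)%:E|%E))//.
  by have /integrableP[] := iGn.
by apply: measurableT_comp => //; exact/measurable_EFinP.
Qed.

Lemma integral_weight_bm :
  (\int[Q]_o (G (bm o u))%:E = \int[normal_prob 0 (Num.sqrt u)]_y (G y)%:E)%E.
Proof.
rewrite -(integral_distribution (X := @to_mfun _ _ Omega (measurableTypeR R) _ (measurable_bm u)) (f := EFin \o G))//.
  by apply: eq_measure_integral => A mA _; exact: bm_u_law.
exact/measurable_EFinP.
Qed.

Definition crossed T := [set o | exists2 t, 0 <= t <= T & 0 <= excess o t].

Let measurable_crossed T : 0 <= T -> measurable (crossed T).
Proof.
move=> T0; apply: measurable_crosses => //; first exact: excess_continuous.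
Qed.

(** At every grid time up to [T] the remaining time is at least [u - T], which fixes [K] before [e]
    and [n]. The sum over [j] of K e Q(A_j) costs no factor [n], by disjointness. *)
Let grid_step_le T : 0 <= T -> T < u -> exists2 K, 0 <= K & forall e n,
  0 < e -> e <= 1 ->
  let D := [set o | exists2 j, (j <= n.+1)%N & grid_crossing (excess o) T n e j] in
  measurable D /\ (`|\int[Q]_(o in D) (G (bm o u))%:E| <= (K * e)%:E)%E.
Proof.
move=> T0 Tu; have uT : 0 < u - T by rewrite subr_gt0.
have [K K0 HK] := weight_mean_near_edge c0 u0 buc uT; exists K => // e n e0 e1 D.
have Ke0 : 0 <= K * e by rewrite mulr_ge0// ltW.
pose A j := [set o | (j <= n.+1)%N /\ grid_crossing (excess o) T n e j].
have HA j : measurable (A j) /\ (`|\int[Q]_(o in A j) (G (bm o u))%:E| <= (K * e)%:E * Q (A j))%E.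
  have [jn|jn] := leqP j n.+1; last first.
    rewrite (_ : A j = set0); first by rewrite integral_set0 measure0 mule0 abse0.
    by apply/seteqP; split => // o [+ _]; rewrite leqNgt jn.
  have g0 : 0 <= grid T n j by exact: grid_ge0.
  have gT : grid T n j <= T by exact: grid_le.
  rewrite (_ : A j = [set o | grid_crossing (fun t => `|bm o t| - (a + b * t)) T n e j]); last first.
    by apply/seteqP; split => o /=; [move=> []|].
  apply: grid_crossing_integral_le => // x xe; apply: HK => //.
  - by rewrite lerB.
  - by rewrite gerBl.
  - by rewrite (_ : c - _ = a + b * grid T n j)//; ring.
have mA j : measurable (A j) by have [] := HA j.
have tA : trivIset setT A.
  apply/trivIsetP => i j _ _; wlog ij : i j / (i < j)%N.
    by move=> W; rewrite neq_ltn => /orP[ij|ij]; [|rewrite setIC]; apply: W; rewrite ?(ltn_eqF ij)// ?(gtn_eqF ij)// ltn_eqF.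
  move=> _; rewrite -subset0 => o [[_ [_ /andP[h1 _]]] [_ [h2 _]]].
  by have := lt_le_trans h1 (h2 _ ij); rewrite ltxx.
have DE : D = \big[setU/set0]_(j <- iota 0 n.+2) A j.
  rewrite -bigcup_seq; apply/seteqP; split => o.
    move=> [j jn cj]; exists j => //; have : j \in iota 0 n.+2 by rewrite mem_iota.
    by [].
  by move=> [j /= _ [jn cj]]; exists j.
have mD : measurable D by rewrite DE; exact: bigsetU_measurable.
split => //; rewrite DE.
have tAs : trivIset [set` iota 0 n.+2] A by exact: sub_trivIset tA.
rewrite integral_bigsetU_EFin ?iota_uniq//; last first.
  by apply/measurable_funTS; exact: measurable_int iG.
apply: (le_trans (lee_abs_sum _ _ _)).
apply: (@le_trans _ _ (\sum_(j <- iota 0 n.+2) (K * e)%:E * Q (A j)))%E.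
  by apply: lee_sum => j _; have [] := HA j.
rewrite -ge0_sume_distrr//.
rewrite -[leRHS]mule1 lee_wpmul2l//.
rewrite -[iota 0 n.+2]/(index_iota 0 n.+2) big_mkord -measure_bigsetU//.
by apply: probability_le1; exact: bigsetU_measurable.
Qed.

Let weight_crossed_lt T : 0 <= T -> T < u -> (\int[Q]_(o in crossed T) (G (bm o u))%:E = 0)%E.
Proof.
move=> T0 Tu; have [K K0 HK] := grid_step_le T0 Tu.
pose E e := [set o | exists2 t, 0 <= t <= T & - e < excess o t].
have mE e : measurable (E e).
  by apply: measurable_exceeds => //; exact: excess_continuous.
(* [e <= 1] is the range of the edge estimate, and [e <= a] puts the starting excess [- a] outside
   the layer. *)
have HE e : 0 < e -> e <= 1 -> e <= a ->
    (`|\int[Q]_(o in E e) (G (bm o u))%:E| <= (K * e)%:E)%E.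
  move=> e0 e1 ea; apply: (set_limit_integral_le iG (D_ := fun n =>
    [set o | exists2 j, (j <= n.+1)%N & grid_crossing (excess o) T n e j])) => //.
  - by move=> n; have [] := HK e n e0 e1.
  - move=> o; right; apply: grid_crossing_near => //; first exact: excess_continuous.
    by rewrite excess0 lerN2.
  - by apply: nearW => n; have [] := HK e n e0 e1.
apply/eqP; rewrite -abse_eq0 eq_le abse_ge0 andbT.
apply/lee_addgt0Pr => M M0; rewrite add0e.
apply: (set_limit_integral_le iG (D_ := fun m => E m.+1%:R^-1)) => //.
- exact: measurable_crossed.
- move=> o; right.
  have [oc|oc] := pselect (crossed T o).
    apply: nearW => m; split => // _; have [t tT ft] := oc; exists t => //.
    by apply: lt_le_trans ft; rewrite oppr_lt0 invr_gt0.
  have [m0 Hm0] : exists m0 : nat, ~ E m0.+1%:R^-1 o.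
    apply: contrapT => /forallNP H; apply: oc.
    apply: ge0_attained => //; first exact: excess_continuous.
    by move=> m; exact: contrapT (H m).
  exists m0 => // m /= m0m; split => // -[t tT ft]; exfalso; apply: Hm0.
  exists t => //; apply: le_lt_trans ft; rewrite lerN2 lef_pV2 ?posrE// ler_nat.
  by rewrite ltnS.
- near=> m.
  (* [K + 1] in place of [K], because [K] may be 0. *)
  have m1 : m.+1%:R^-1 <= Num.min (Num.min 1 a) (M / (K + 1)) :> R.
    have d0 : 0 < Num.min (Num.min 1 a) (M / (K + 1)).
      by rewrite !lt_min ltr01 a0 divr_gt0// ltr_wpDl.
    rewrite -[leRHS]invrK lef_pV2 ?posrE ?invr_gt0//.
    apply: (@le_trans _ _ m%:R); last by rewrite ler_nat.
    by near: m; exact: nbhs_infty_ger.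
  move: m1; rewrite !le_min => /andP[/andP[m1 ma] mM].
  apply: (le_trans (HE _ _ m1 ma)); first by rewrite invr_gt0.
  rewrite lee_fin (@le_trans _ _ ((K + 1) * m.+1%:R^-1))//.
    by rewrite ler_wpM2r// ?invr_ge0// lerDl.
  by rewrite mulrC -ler_pdivlMr// ltr_wpDl.
Unshelve. all: by end_near. Qed.

Let weight_crossed : (\int[Q]_(o in crossed u) (G (bm o u))%:E = 0)%E.
Proof.
pose s n : R := u * (1 - n.+1%:R^-1).
have s0 n : 0 <= s n.
  by rewrite mulr_ge0 ?(ltW u0)// subr_ge0 invf_le1// ler1n.
have su n : s n < u by rewrite gtr_pMr// ltrBlDr ltrDl invr_gt0.
apply/eqP; rewrite -abse_eq0 eq_le abse_ge0 andbT.
apply: (set_limit_integral_le iG (D_ := fun n => crossed (s n))) => //.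
- by move=> n; exact: measurable_crossed.
- by apply: measurable_crossed; exact: ltW.
- move=> o; have [[t /andP[t0 tu] ft]|H] := pselect (exists2 t, 0 <= t < u & 0 <= excess o t).
    right; near=> n; split => [[v /andP[v0 vs] fv]|_].
      by exists v => //; rewrite v0 (le_trans vs)// ltW.
    exists t => //; rewrite t0/= /s mulrBr mulr1 lerBrDr -lerBrDl.
    rewrite ler_pdivrMr// mulrC -ler_pdivrMr ?subr_gt0//.
    apply: (@le_trans _ _ n%:R); last by rewrite ler_nat.
    by near: n; exact: nbhs_infty_ger.
  have [fu|fu] := leP 0 (excess o u); last first.
    right; apply: nearW => n; split => -[v /andP[v0 vs] fv]; exfalso.
      by apply: H; exists v => //; rewrite v0 (le_lt_trans vs).
    have [vu|vu|vu] := ltgtP v u; [by apply: H; exists v; rewrite ?v0| |].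
      by move: vs; rewrite leNgt vu.
    by move: fv; rewrite vu leNgt fu.
  (* Here the only contact is at [u]. The excess there is exactly 0, since a positive value would
     persist at earlier times; so |B_u| = c and the weight is 0. *)
  left; apply: reflected_weight_edge => //; apply/eqP; rewrite -subr_eq0 -/(excess o u).
  rewrite eq_le fu andbT.
  rewrite leNgt; apply/negP => fu0.
  have [r r0 Hr] : exists2 r : R, 0 < r & forall v, `|u - v| < r -> 0 < excess o v.
    have /cvgrPdist_lt /(_ _ fu0) := @excess_continuous o u.
    move=> /nbhs_ballP[r /= r0 Hr]; exists r => // v uv.
    by have := Hr v uv; rewrite ltr_norml => /andP[_]; rewrite gtrBl.
  apply: H; have dm : 0 < Num.min u (r / 2) by rewrite lt_min u0 divr_gt0.
  exists (u - Num.min u (r / 2)).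
    by rewrite subr_ge0 ge_min lexx/= gtrBl.
  rewrite ltW//; apply: Hr; rewrite opprB addrC subrK gtr0_norm//.
  by rewrite gt_min; apply/orP; right; rewrite gtr_pMr// invf_lt1// ltr1n.
- by apply: nearW => n; rewrite weight_crossed_lt// abse0.
Unshelve. all: by end_near. Qed.

Lemma no_crossing_probability :
  Q [set o | forall t, 0 <= t <= u -> excess o t < 0] =
  (\int[normal_prob 0 (Num.sqrt u)]_y (G y)%:E)%E.
Proof.
have mC : measurable (crossed u) by apply: measurable_crossed; exact: ltW.
rewrite -integral_weight_bm -[in RHS](setvU (crossed u)) integral_setU//.
- rewrite weight_crossed adde0 (eq_integral (cst 1%E)); last first.
    move=> o; rewrite inE => /= oc; rewrite reflected_weight1//.
    have : ~ 0 <= excess o u by move=> h; apply: oc; exists u => //; rewrite lexx ltW.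
    by move=> /negP; rewrite -ltNge /excess subr_lt0.
  rewrite integral_cst ?mul1e//; last exact: measurableC.
  congr (Q _); apply/seteqP; split => o /=.
    by move=> H [t /H]; rewrite ltNge => /negP.
  by move=> H t tu; rewrite ltNge; apply/negP => ft; apply: H; exists t.
- exact: measurableC.
- by rewrite setvU; exact: measurable_int iG.
- by apply/disj_set2P; rewrite setICl.
Qed.

End crossing.
End brownian.

(** * The series Delta *)

Section geometric_domination.
Context (R : realType) (M z : R) (M0 : 0 <= M) (z0 : 0 < z) (z1 : z < 1).

(** The sum of M z^m over m >= n; its consecutive differences telescope against the terms. *)
Definition geometric_tail (n : nat) : R := M * z ^+ n / (1 - z).

Let z1' : 0 < 1 - z. Proof. by rewrite subr_gt0. Qed.

Lemma geometric_tailS n : geometric_tail n - geometric_tail n.+1 = M * z ^+ n.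
Proof. by rewrite /geometric_tail exprS; field; rewrite gt_eqF. Qed.

Lemma geometric_tail_ge0 n : 0 <= geometric_tail n.
Proof. by rewrite /geometric_tail divr_ge0 ?mulr_ge0 ?exprn_ge0// ltW. Qed.

Lemma geometric_tail_ltS n : geometric_tail n.+1 <= geometric_tail n.
Proof. by rewrite -subr_ge0 geometric_tailS mulr_ge0// exprn_ge0// ltW. Qed.

Lemma cvg_geometric_tail : geometric_tail n @[n --> \oo] --> 0.
Proof.
have zn : `|z| < 1 by rewrite gtr0_norm.
have := cvg_geometric (M / (1 - z)) zn.
by under [X in _ -> X @ _ --> _]eq_fun do rewrite /geometric_tail mulrAC.
Qed.

Section sequence.
Variables (v : nat -> R) (vM : forall n, `|v n| <= M * z ^+ n).

Lemma geometric_cvg : cvgn (series v).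
Proof.
have zn : `|z| < 1 by rewrite gtr0_norm.
apply: normed_cvg; apply: (@series_le_cvg _ _ (geometric M z)) => //.
  by move=> n; exact: normr_ge0.
  by move=> n; rewrite /geometric/= mulr_ge0// exprn_ge0// ltW.
exact: is_cvg_geometric_series.
Qed.

Let partial n p : `|series v (n + p)%N - series v n| <= geometric_tail n - geometric_tail (n + p).
Proof.
elim: p => [|p IH]; first by rewrite addn0 !subrr normr0.
rewrite addnS seriesSr.
have -> : series v (n + p)%N + v (n + p)%N - series v n =
  (series v (n + p)%N - series v n) + v (n + p)%N by rewrite addrAC.
apply: (le_trans (ler_normD _ _)); apply: (le_trans (lerD IH (vM _))).
by rewrite -geometric_tailS; lra.
Qed.

Lemma geometric_lim_dist n : `|limn (series v) - series v n| <= geometric_tail n.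
Proof.
have cvn : `|series v m - series v n| @[m --> \oo] --> `|limn (series v) - series v n|.
  by apply: cvg_norm; apply: cvgB; [exact: geometric_cvg|exact: cvg_cst].
apply: (@closed_cvg _ _ \oo _ _ (fun x => x <= geometric_tail n) _ _ _ cvn).
  exact: closed_le.
exists n => // m /= nm; rewrite -(subnKC nm) (le_trans (partial _ _))//.
by rewrite gerBl geometric_tail_ge0.
Qed.

End sequence.

Section bilateral.
Variables (f : int -> R) (fM : forall k, `|f k| <= M * z ^+ `|k|).

Let fP n : `|f (Posz n)| <= M * z ^+ n. Proof. exact: fM. Qed.

Let fN n : `|f (Negz n)| <= M * z ^+ n.
Proof.
apply: (le_trans (fM _)); rewrite ler_wpM2l// NegzE abszN/= exprS ler_piMl ?exprn_ge0// ltW//.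
Qed.

Lemma geometric_bilateral_cvg : bilateral_cvg f.
Proof. by split; exact: geometric_cvg. Qed.

(** The window from - N to N has N + 1 nonnegative and N negative indices, the latter met in reverse
    order by [Negz]. *)
Lemma sym_sumE N : sym_sum f N = series (f \o Posz) N.+1 + series (f \o Negz) N.
Proof.
rewrite /sym_sum -addnn -addnS big_split_ord/= addrC; congr (_ + _).
  rewrite /series/= big_mkord; apply: eq_bigr => i _; congr f.
  by rewrite PoszD addrAC subrr add0r.
rewrite /series/= big_mkord (reindex_inj rev_ord_inj)/=; apply: eq_bigr => i _.
by congr f; rewrite -subzn// NegzE; ring.
Qed.

Lemma bilateral_sum_dist N : `|bilateral_sum f - sym_sum f N| <= 2 * geometric_tail N.
Proof.
rewrite sym_sumE /bilateral_sum.
have h1 := geometric_lim_dist fP N.+1; have h2 := geometric_lim_dist fN N.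
rewrite opprD addrACA (le_trans (ler_normD _ _))// mulr2n mulrDl !mul1r lerD//.
exact: le_trans (geometric_tail_ltS N).
Qed.

Lemma sym_sum_cvg : sym_sum f N @[N --> \oo] --> bilateral_sum f.
Proof.
apply/cvgrPdist_le => e e0.
have h : 2 * geometric_tail N @[N --> \oo] --> (2 * 0 : R).
  by apply: cvgM; [exact: cvg_cst|exact: cvg_geometric_tail].
rewrite mulr0 in h; move/cvgrPdist_le : h => /(_ e e0).
apply: filterS => N; rewrite sub0r normrN ger0_norm; last by rewrite mulr_ge0// geometric_tail_ge0.
by apply: le_trans; exact: bilateral_sum_dist.
Qed.

Lemma bilateral_sum_le : `|bilateral_sum f| <= 2 * geometric_tail 0.
Proof.
have := geometric_lim_dist fP 0; have := geometric_lim_dist fN 0.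
rewrite /series/= !big_geq// !subr0 => h1 h2.
by rewrite (le_trans (ler_normD _ _))// mulr2n mulrDl !mul1r lerD.
Qed.

Lemma sym_sum_le N : `|sym_sum f N| <= 4 * geometric_tail 0.
Proof.
have tN : geometric_tail N <= geometric_tail 0.
  by elim: N => // N; apply: le_trans; exact: geometric_tail_ltS.
have -> : sym_sum f N = bilateral_sum f - (bilateral_sum f - sym_sum f N) by lra.
apply: (le_trans (ler_normB _ _)); have := bilateral_sum_le; have := bilateral_sum_dist N.
lra.
Qed.

End bilateral.
End geometric_domination.

Section Delta_bounds.
Context (R : realType) (a b : R) (a0 : 0 < a).
Implicit Types (u s t : R) (k : int).

(** The rate a (a + b u) / u = a^2 / u + a b decreases in [u], so its value [q] at [t] is the least
    one. As k (k - 1) >= |k| - 1, the exponentials are at most exp (2 q - 2 q |k|). Half of this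
    decay absorbs the linear factor, through q |k| <= exp (q |k|), and leaves z = exp (- q). *)
Lemma Delta_term_le s t : 0 < s -> 0 < a + b * t -> exists M z,
  [/\ 0 <= M, 0 < z, z < 1 & forall u k, s <= u -> u <= t ->
     `|Delta_term a b u k| <= M * z ^+ `|k|].
Proof.
move=> s0 ct; have [t0|t0] := leP t 0.
  exists 0, (2^-1); split => //; first by rewrite invf_lt1// ltr1n.
  by move=> u k su ut; have := lt_le_trans s0 (le_trans su (le_trans ut t0)); rewrite ltxx.
pose q := a * ((a + b * t) / t).
have q0 : 0 < q by rewrite mulr_gt0// divr_gt0.
exists ((a + `|b| * t + 2 * a / q) * expR (2 * q)), (expR (- q)).
have ab0 : 0 <= a + `|b| * t by rewrite addr_ge0 ?mulr_ge0// ltW.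
split.
- by apply: mulr_ge0; rewrite ?expR_ge0// addr_ge0// divr_ge0 ?(ltW q0)// mulr_ge0// ltW.
- exact: expR_gt0.
- by rewrite -expR0 ltr_expR oppr_lt0.
move=> u k su ut; have u0 : 0 < u by exact: lt_le_trans su.
pose K : R := `|k%:~R|.
have KE : `|k|%N%:R = K by rewrite /K natr_absz intr_norm.
have K0 : 0 <= K by exact: normr_ge0.
have qu : q <= a * ((a + b * u) / u).
  have e v : 0 < v -> (a + b * v) / v = a * v^-1 + b by move=> v0; field; rewrite gt_eqF.
  by rewrite /q !e// ler_pM2l// lerD2r ler_pM2l// lef_pV2.
have kk : K - 1 <= k%:~R * (k%:~R - 1) /\ 0 <= k%:~R * (k%:~R - 1) :> R.
  rewrite /K; have [k0|k0] := leP 1 k.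
    have k1 : 1 <= k%:~R :> R by rewrite -[1]/(1%:~R) ler_int.
    by rewrite ger0_norm; [nra|lra].
  have k1 : k%:~R <= 0 :> R by rewrite -[0]/(0%:~R) ler_int -ltzD1.
  by rewrite ler0_norm//; nra.
have [kk1 kk2] := kk.
rewrite /Delta_term -mulrA -expRD normrM (ger0_norm (expR_ge0 _)).
rewrite normrM expN1r normrX normrN1 expr1n mul1r.
have h1 : `|a - b * u - 2 * k%:~R * a| <= a + `|b| * t + 2 * a * K.
  apply: (le_trans (ler_normB _ _)); apply: lerD.
    apply: (le_trans (ler_normB _ _)); rewrite normrM (gtr0_norm a0) (gtr0_norm u0).
    by rewrite lerD2l ler_wpM2l.
  by rewrite !normrM (gtr0_norm a0) ger0_norm// mulrAC.
have h2 : 2 * a * K <= 2 * a / q * expR (q * K).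
  have := expR_ge1Dx (q * K) => h.
  have : q * K <= expR (q * K) by lra.
  move=> qK; have -> : 2 * a / q * expR (q * K) = 2 * a * (expR (q * K) / q).
    by field; rewrite gt_eqF.
  by apply: ler_wpM2l; [rewrite mulr_ge0// ltW|rewrite ler_pdivlMr// mulrC].
have h3 : a + `|b| * t + 2 * a * K <= (a + `|b| * t + 2 * a / q) * expR (q * K).
  have : 1 <= expR (q * K) by rewrite -expR0 ler_expR mulr_ge0// ltW.
  move=> e1; rewrite [leRHS]mulrDl; apply: lerD => //.
  by rewrite ler_peMr.
(* The exponent is [- c^2 / (2 u) - 2 (a c / u) k (k - 1)] with [c = a + b u]. *)
have h4 : - 2 * k%:~R ^+ 2 * a * b + - (a + b * u - 2 * k%:~R * a) ^+ 2 / (2 * u) <= 2 * q - 2 * q * K.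
  have -> : - 2 * k%:~R ^+ 2 * a * b + - (a + b * u - 2 * k%:~R * a) ^+ 2 / (2 * u) =
    - ((a + b * u) ^+ 2 / (2 * u)) - 2 * (a * ((a + b * u) / u)) * (k%:~R * (k%:~R - 1)).
    by field; rewrite gt_eqF.
  have : 0 <= (a + b * u) ^+ 2 / (2 * u) by rewrite divr_ge0 ?sqr_ge0// mulr_ge0// ltW.
  have := ler_wpM2r kk2 qu; have := ler_wpM2l (ltW q0) kk1.
  move: (a * _) (k%:~R * _) (_ / (2 * u)) => x1 x2 x3; lra.
apply: (@le_trans _ _ ((a + `|b| * t + 2 * a / q) * expR (q * K) * expR (2 * q - 2 * q * K))).
  by apply: ler_pM; rewrite ?expR_ge0// ?ler_expR// (le_trans h1).
have -> : expR (- q) ^+ `|k| = expR (- (q * K)).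
  by rewrite -expRM_natl KE; congr expR; ring.
rewrite -[leLHS]mulrA -expRD -[leRHS]mulrA -expRD.
have -> : q * K + (2 * q - 2 * q * K) = 2 * q - q * K by ring.
exact: lexx.
Qed.

End Delta_bounds.

Section Delta.
Context (R : realType) (a b : R) (a0 : 0 < a).
Notation mu := (@lebesgue_measure R).
Implicit Types (u s t : R) (k : int) (N : nat).

Lemma admissibleE u : admissible a b u <-> 0 < u /\ 0 < a + b * u.
Proof.
split=> -[u0 H]; split=> //.
  have [b0|b0] := ltP b 0; last by rewrite ltr_wpDr// mulr_ge0// ltW.
  by have := H b0; rewrite ltr_ndivlMr//; lra.
by move=> b0; rewrite ltr_ndivlMr//; lra.
Qed.

Lemma continuous_Delta_term u k : 0 < u ->
  {for u, continuous (fun v => Delta_term a b v k)}.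
Proof.
move=> u0; apply: cvgM.
  apply: cvgM; last exact: cvg_cst.
  apply: cvgM; first exact: cvg_cst.
  apply: cvgB; last exact: cvg_cst.
  apply: cvgB; first exact: cvg_cst.
  by apply: cvgM; [exact: cvg_cst|exact: cvg_id].
apply: (cvg_comp _ expR); last exact: continuous_expR.
apply: cvgM.
  apply: cvgN; apply: (cvg_comp _ (fun x => x ^+ 2)); last exact: sqr_continuous.
  apply: cvgB; last exact: cvg_cst.
  apply: cvgD; first exact: cvg_cst.
  by apply: cvgM; [exact: cvg_cst|exact: cvg_id].
apply: cvgV; first by rewrite mulf_neq0// gt_eqF.
by apply: cvgM; [exact: cvg_cst|exact: cvg_id].
Qed.

Lemma continuous_sym_sum (f : R -> int -> R) u N :
  (forall k, {for u, continuous (f^~ k)}) ->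
  {for u, continuous (fun v => sym_sum (f v) N)}.
Proof.
move=> cf; rewrite /sym_sum; elim: (N.*2.+1) => [|n IH].
  rewrite (_ : (fun v => _) = cst 0); first exact: cvg_cst.
  by apply/funext => v; rewrite big_ord0.
rewrite (_ : (fun v => _) =
  (fun v => \sum_(i < n) f v (i%:Z - N%:Z) + f v (n%:Z - N%:Z))); first exact: (cvgD IH (cf _)).
by apply/funext => v; rewrite big_ord_recr.
Qed.

Definition Delta_factor u : R := (Num.sqrt (2 * pi * u ^+ 3))^-1.

Lemma continuous_Delta_factor u : 0 < u -> {for u, continuous Delta_factor}.
Proof.
move=> u0; apply: cvgV.
  by rewrite gt_eqF// sqrtr_gt0 !mulr_gt0 ?pi_gt0// exprn_gt0.
apply: (cvg_comp _ (@Num.sqrt R)); last exact: sqrt_continuous.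
apply: cvgM; first exact: cvg_cst.
exact: exprn_continuous.
Qed.

(** The normal density is even, so the two [Phi] contribute equally: twice the density at x(u) times
    x'(u), with x'(u) = (b u - m) / (2 u^(3/2)). The 2 cancels. *)
Lemma is_derive_survival_term u k : 0 < u ->
  is_derive u 1 (fun v => survival_term a b v k) (- (Delta_factor u * Delta_term a b u k)).
Proof.
move=> u0; have su0 : 0 < Num.sqrt u by rewrite sqrtr_gt0.
have su2 : Num.sqrt u ^+ 2 = u by rewrite sqr_sqrtr ?ltW.
have sE : Num.sqrt (2 * pi * u ^+ 3) = Num.sqrt (2 * pi) * (Num.sqrt u) ^+ 3 :> R.
  have -> : u ^+ 3 = (Num.sqrt u ^+ 3) ^+ 2 by rewrite -exprM mulnC exprM su2.
  by rewrite sqrtrM ?mulr_ge0 ?pi_ge0// sqrtr_sqr gtr0_norm// exprn_gt0.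
have tp0 : 0 < Num.sqrt (2 * pi) :> R by rewrite sqrtr_gt0 mulr_gt0 ?pi_gt0.
pose w : R := (-1) ^ k * expR (- 2 * k%:~R ^+ 2 * a * b).
pose m : R := a - 2 * k%:~R * a.
pose x v := (m + b * v) * (Num.sqrt v)^-1.
pose dx := b * (Num.sqrt u)^-1 - (m + b * u) * (Num.sqrt u) ^- 2 * (2 * Num.sqrt u)^-1.
have dxE : is_derive u 1 x dx.
  have d1 : is_derive u 1 (fun v => m + b * v) b.
    have := is_deriveD (is_derive_cst m u 1) (is_deriveZ b (is_derive_id u 1)).
    by rewrite add0r [_ *: _]mulr1.
  have d2 : is_derive u 1 (fun v => (Num.sqrt v)^-1) (- Num.sqrt u ^- 2 *: (2 * Num.sqrt u)^-1).
    by apply: is_deriveV; [rewrite gt_eqF|exact: is_derive1_sqrt].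
  have := is_deriveM d1 d2; congr (is_derive _ _ _ _).
  by rewrite /dx /GRing.scale/=; ring.
have -> : (fun v => survival_term a b v k) = w \*: ((@Phi R \o x) - (@Phi R \o (- x))).
  apply/funext => v; rewrite /survival_term -/w.
  have -> : a + b * v - 2 * k%:~R * a = m + b * v by rewrite /m; ring.
  by [].
have -> : - (Delta_factor u * Delta_term a b u k) = w *: (std_pdf (x u) * dx - std_pdf (- x u) * - dx).
  rewrite std_pdfN /std_pdf /Delta_factor sE /Delta_term.
  have -> : - x u ^+ 2 / 2 = - (a + b * u - 2 * k%:~R * a) ^+ 2 / (2 * u).
    by rewrite /x exprMn exprVn su2 /m; field; rewrite gt_eqF.
  rewrite /w /GRing.scale/=.
  move: (expR (- (a + b * u - 2 * k%:~R * a) ^+ 2 / (2 * u))) (expR (- 2 * _ * _ * _)) ((-1) ^ k) => e1 e2 e3.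
  have -> : a - b * u - 2 * k%:~R * a = m - b * u by rewrite /m; ring.
  rewrite /dx; move: su2 su0 tp0; move: (Num.sqrt u) (Num.sqrt (2 * pi)) => q p <- q0 p0.
  by field; rewrite !gt_eqF.
apply: is_deriveZ; apply: is_deriveB; apply: is_derive1_comp; exact: is_derive_Phi.
Qed.

Section compact_interval.
Variables (s t : R) (s0 : 0 < s) (ct : 0 < a + b * t).

Lemma bilateral_cvg_Delta_term u : s <= u -> u <= t -> bilateral_cvg (Delta_term a b u).
Proof.
move=> su ut; have [M [z [M0 z0 z1 H]]] := Delta_term_le a0 s0 ct.
by apply: (geometric_bilateral_cvg M0 z0 z1) => k; exact: H.
Qed.

Lemma continuous_bilateral_Delta u : s < u -> u < t ->
  {for u, continuous (fun v => bilateral_sum (Delta_term a b v))}.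
Proof.
move=> su ut; have [M [z [M0 z0 z1 H]]] := Delta_term_le a0 s0 ct.
have u0 : 0 < u by exact: lt_trans su.
(* The bilateral remainder is at most two tails, hence below e / 4, at [u] and again at [v]; the
   partial sum gets e / 2. *)
apply/cvgrPdist_lt => e e0; have e8 : 0 < e / 8 by rewrite divr_gt0.
have [N _ HN] : \forall N \near \oo, geometric_tail M z N < e / 8.
  have /cvgrPdist_lt /(_ _ e8) := cvg_geometric_tail M z0 z1.
  by apply: filterS => N; rewrite sub0r normrN => /(le_lt_trans (ler_norm _)).
have {}HN := HN N (leqnn N).
have cS : {for u, continuous (fun v => sym_sum (Delta_term a b v) N)}.
  by apply: continuous_sym_sum => k; exact: continuous_Delta_term.
have /cvgrPdist_lt /(_ (e / 2)) := cS; rewrite divr_gt0// => /(_ isT) cSe.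
have d v : s <= v -> v <= t -> `|bilateral_sum (Delta_term a b v) - sym_sum (Delta_term a b v) N| < e / 4.
  move=> sv vt; have := bilateral_sum_dist M0 z0 z1 (fun k => H v k sv vt) N; lra.
near=> v.
have sv : s <= v by rewrite ltW//; near: v; exact: lt_nbhsr.
have vt : v <= t by rewrite ltW//; near: v; exact: lt_nbhsl.
have h1 := d u (ltW su) (ltW ut); have h2 := d v sv vt.
have h3 : `|sym_sum (Delta_term a b u) N - sym_sum (Delta_term a b v) N| < e / 2 by near: v.
move: h1 h2 h3; move: (bilateral_sum _) (bilateral_sum _) (sym_sum _ N) (sym_sum _ N) => x1 x2 x3 x4.
by rewrite !ltr_norml => /andP[? ?] /andP[? ?] /andP[? ?]; apply/andP; split; lra.
Unshelve. all: by end_near. Qed.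

(** The series is never differentiated. Its symmetric partial sums are integrated exactly over ]s,
    t], and the same sequence has two limits: one from the survival values, one by dominated
    convergence. *)
Lemma survival_increment (Ls Lt : R) : s <= t ->
  sym_sum (survival_term a b s) N @[N --> \oo] --> Ls ->
  sym_sum (survival_term a b t) N @[N --> \oo] --> Lt ->
  (\int[mu]_(u in `]s, t]) (Delta a b u)%:E = (Ls - Lt)%:E)%E.
Proof.
move=> st cs ct'; have [M [z [M0 z0 z1 H]]] := Delta_term_le a0 s0 ct.
pose f N u := Delta_factor u * sym_sum (Delta_term a b u) N.
have f_cts N u : 0 < u -> {for u, continuous (f N)}.
  move=> u0; apply: cvgM; first exact: continuous_Delta_factor.
  by apply: continuous_sym_sum => k; exact: continuous_Delta_term.
have fE N : (\int[mu]_(u in `]s, t]) (f N u)%:E =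
    (sym_sum (survival_term a b s) N - sym_sum (survival_term a b t) N)%:E)%E.
  have -> : sym_sum (survival_term a b s) N - sym_sum (survival_term a b t) N =
    - sym_sum (survival_term a b t) N - (- sym_sum (survival_term a b s) N) by ring.
  apply: (@integral_oc_is_derive _ (f N) (fun v => - sym_sum (survival_term a b v) N) s t st).
  - move=> v /andP[sv vt]; have v0 : 0 < v by exact: lt_le_trans sv.
    have -> : f N v = - \sum_(i < N.*2.+1) - (Delta_factor v * Delta_term a b v (i%:Z - N%:Z)).
      by rewrite sumrN opprK /f /sym_sum mulr_sumr.
    have -> : (fun v => - sym_sum (survival_term a b v) N) =
        - \sum_(i < N.*2.+1) (fun v => survival_term a b v (i%:Z - N%:Z)).
      by apply/funext => x; rewrite /sym_sum fctE fct_sumE.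
    by apply: is_deriveN; apply: is_derive_sum => i; exact: is_derive_survival_term.
  - move=> v /andP[sv vt]; have v0 : 0 < v by exact: lt_le_trans sv.
    exact: f_cts.
have c1 : (\int[mu]_(u in `]s, t]) (f N u)%:E)%E @[N --> \oo] --> (Ls - Lt)%:E.
  under eq_fun do rewrite fE.
  by apply: cvg_EFin; [exact: nearW|exact: cvgB].
have c2 : (\int[mu]_(u in `]s, t]) (f N u)%:E)%E @[N --> \oo] -->
    (\int[mu]_(u in `]s, t]) (Delta a b u)%:E)%E.
  (* The prefactor decreases in [u], so its value at [s] bounds it on the whole interval. *)
  pose C := Delta_factor s * (4 * geometric_tail M z 0).
  apply: (@dominated_cvg _ _ _ mu `]s, t]%classic _ _ _ (fun=> C%:E)) => //.
  - move=> N; apply/measurable_EFinP; apply: (@measurable_funS _ _ _ _ `[s, t]%classic) => //.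
      exact: subset_itv_oc_cc.
    apply: subspace_continuous_measurable_fun => //.
    apply: continuous_in_subspaceT => u; rewrite inE/= in_itv/= => /andP[su ut].
    exact: f_cts (lt_le_trans s0 su).
  - move=> u /=; rewrite in_itv/= => /andP[su ut].
    apply: cvg_EFin; first exact: nearW.
    apply: cvgM; first exact: cvg_cst.
    by apply: (sym_sum_cvg M0 z0 z1) => k; exact: H (ltW su) ut.
  - apply: (@integrableS _ _ _ mu `[s, t]%classic) => //; first exact: subset_itv_oc_cc.
    apply: (@continuous_compact_integrable _ (cst C)); first exact: segment_compact.
    by apply: continuous_subspaceT; exact: cst_continuous.
  - move=> N u /=; rewrite in_itv/= => /andP[su ut]; rewrite lee_fin /f normrM.
    have u0 : 0 < u by exact: lt_trans su.
    apply: ler_pM => //.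
      rewrite ger0_norm ?invr_ge0 ?sqrtr_ge0// lef_pV2 ?posrE ?sqrtr_gt0 ?mulr_gt0 ?pi_gt0 ?exprn_gt0//.
      rewrite ler_wsqrtr// ler_pM2l ?mulr_gt0 ?pi_gt0// lerXn2r ?nnegrE// ltW//.
    by apply: (sym_sum_le M0 z0 z1) => k; exact: H (ltW su) ut.
exact: (cvg_unique _ c2 c1).
Qed.

End compact_interval.
End Delta.

(** * Laws with a density *)

Section density_from_increments.
Context (R : realType) d (T : measurableType d) (P : probability T R).
Variables (X : T -> \bar R) (D : set R) (f : R -> R).
Notation mu := (@lebesgue_measure R).
Hypotheses (mX : measurable_fun setT X) (oD : open D).
Hypothesis convD : forall x y z, D x -> D y -> x <= z -> z <= y -> D z.
Hypothesis cf : forall x, D x -> {for x, continuous f}.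
Hypothesis incr : forall s t, D s -> D t -> s <= t ->
  P [set w | (s%:E < X w)%E /\ (X w <= t%:E)%E] = (\int[mu]_(x in `]s, t]) (f x)%:E)%E.

Let mf : measurable_fun D f.
Proof.
by apply: open_continuous_measurable_fun => // x; rewrite inE; exact: cf.
Qed.

Let mD : measurable D. Proof. exact: open_measurable. Qed.

Let ocD s t : D s -> D t -> `]s, t] `<=` D.
Proof.
move=> Ds Dt x /=; rewrite in_itv/= => /andP[sx xt]; exact: convD Ds Dt (ltW sx) xt.
Qed.

Let nbhsD x : D x -> exists2 e : R, 0 < e & forall y, `|x - y| < e -> D y.
Proof.
move=> Dx; have /nbhs_ballP[e /= e0 He] : nbhs x D by exact: open_nbhs_nbhs.
by exists e.
Qed.

(** A negative value would, by continuity, make the integral over a short interval negative, whereas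
    it is a probability. The sign is what makes the integral countably additive below. *)
Let f_ge0 x : D x -> 0 <= f x.
Proof.
move=> Dx; rewrite leNgt; apply/negP => fx.
have [e e0 De] := nbhsD Dx.
have [r r0 Hr] : exists2 r : R, 0 < r & forall y, `|x - y| < r -> f y < f x / 2.
  have fx2 : 0 < - f x / 2 by lra.
  have /cvgrPdist_lt /(_ _ fx2) := cf Dx.
  move=> /nbhs_ballP[r /= r0 Hr]; exists r => // y xy.
  by have := Hr y xy; rewrite ltr_norml => /andP[h1 h2]; move: h1 h2; move: (f x) (f y) => p q; lra.
pose h := Num.min e r / 2.
have h0 : 0 < h by rewrite divr_gt0// lt_min e0.
have hm : h < Num.min e r by rewrite gtr_pMr ?lt_min ?e0// invf_lt1// ltr1n.
have near_x y : x <= y -> y <= x + h -> `|x - y| < Num.min e r.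
  by move=> xy yh; rewrite distrC ger0_norm ?subr_ge0//; apply: le_lt_trans hm; rewrite lerBlDl.
have Dxh : D (x + h).
  apply: De; have := near_x (x + h); rewrite lerDl ltW// lexx => /(_ isT isT).
  by rewrite lt_min => /andP[].
have fneg y : y \in `]x, x + h] -> f y < f x / 2.
  rewrite in_itv/= => /andP[xy yh]; apply: Hr.
  by have := near_x y (ltW xy) yh; rewrite lt_min => /andP[].
have xh : x <= x + h by rewrite lerDl ltW.
have : (0 <= \int[mu]_(y in `]x, (x + h)%R]) (f y)%:E)%E by rewrite -incr.
apply/negP; rewrite -ltNge.
have -> : (\int[mu]_(y in `]x, (x + h)%R]) (f y)%:E = - \int[mu]_(y in `]x, (x + h)%R]) (- f y)%:E)%E.
  rewrite -integral_ge0N; first by apply: eq_integral => y _; rewrite EFinN oppeK.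
  by move=> y yI; have fy := fneg y yI; rewrite lee_fin; move: fx fy; move: (f x) (f y) => p q; lra.
rewrite oppe_lt0; apply: (@lt_le_trans _ _ (\int[mu]_(y in `]x, (x + h)%R]) (- (f x / 2))%:E)%E).
  rewrite integral_cst//= lebesgue_measure_itv/= lte_fin ltrDl h0 -EFinD -EFinM lte_fin.
  by rewrite mulr_gt0//; [lra|rewrite addrAC subrr add0r].
apply: ge0_le_integral => //.
- by move=> y _; rewrite lee_fin; lra.
- apply/measurable_EFinP; apply: measurable_funN; apply: (measurable_funS mD) => //; exact: ocD.
- by move=> y yI; have fy := fneg y yI; rewrite lee_fin lerN2 ltW.
Qed.

Let E (A : set R) := [set w | (EFin @` A) (X w)].

Let mE A : measurable A -> measurable (E A).
Proof.
move=> mA; rewrite -[X in measurable X]setTI; apply: mX => //.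
exact: measurable_image_EFin.
Qed.

Let E_bigcup (F : (set R)^nat) : E (\bigcup_n F n) = \bigcup_n E (F n).
Proof.
apply/seteqP; split => w /=.
  by move=> [x [n _ Fx] xw]; exists n => //; exists x.
by move=> [n _ [x Fx xw]]; exists x => //; exists n.
Qed.

Let E_disj A B : A `&` B = set0 -> E A `&` E B = set0.
Proof.
rewrite -!subset0 => AB w [[x Ax xw] [y By yw]].
have yx : y = x by apply: EFin_inj; rewrite yw.
by rewrite yx in By; exact: AB (conj Ax By).
Qed.

Let trivE (F : (set R)^nat) : trivIset setT F -> trivIset setT (E \o F).
Proof.
move=> tF; apply/trivIsetP => i j _ _ ij; apply: E_disj.
by move/trivIsetP : tF; exact.
Qed.

Let Eoc s t : E `]s, t] = [set w | (s%:E < X w)%E /\ (X w <= t%:E)%E].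
Proof.
apply/seteqP; split => w /=.
  by move=> [x xst <-]; move: xst; rewrite lte_fin lee_fin => /andP[].
case Xw : (X w) => [x| |] [sx xt].
- exists x; last by rewrite Xw.
  by move: sx xt; rewrite lte_fin lee_fin /= in_itv/= => -> ->.
- by move: xt; rewrite leNgt ltry.
- by move: sx; rewrite ltNge leNye.
Qed.

Let density_bigcup (F : (set R)^nat) : (forall n, measurable (F n)) -> trivIset setT F ->
  (forall n, F n `<=` D) -> (forall n, P (E (F n)) = \int[mu]_(x in F n) (f x)%:E)%E ->
  (P (E (\bigcup_n F n)) = \int[mu]_(x in \bigcup_n F n) (f x)%:E)%E.
Proof.
move=> mF tF FD H; rewrite E_bigcup measure_bigcup//; last 2 first.
- by move=> n _; exact: mE.
- exact: trivE.
rewrite ge0_integral_bigcup//.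
- rewrite (eq_eseriesl (Q := xpredT)); last by move=> n; rewrite in_setT.
  by apply: eq_eseriesr => n _; exact: H.
- apply/measurable_EFinP; apply: (measurable_funS mD) => //; exact: bigcup_sub.
- by move=> x [n _ Fx]; rewrite lee_fin; apply: f_ge0; exact: FD Fx.
Qed.

(** A Dynkin argument inside one interval ]s, t]; complements are taken within it, by subtracting
    finite probabilities. *)
Let density_oc s t A : D s -> D t -> measurable A ->
  (P (E (A `&` `]s, t])) = \int[mu]_(x in A `&` `]s, t]) (f x)%:E)%E.
Proof.
move=> Ds Dt; pose I := `]s, t]%classic.
have [st|ts] := leP s t; last first.
  move=> _; have -> : `]s, t]%classic = set0 :> set R.
    by apply/seteqP; split => // x /=; rewrite in_itv/= => /andP[sx xt]; have := lt_trans ts (lt_le_trans sx xt); rewrite ltxx.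
  rewrite setI0 integral_set0 (_ : E set0 = set0) ?measure0//.
  by apply/seteqP; split => // w [].
have ID : I `<=` D by exact: ocD.
have mI : measurable I by exact: measurable_itv.
have mfI B : measurable B -> B `<=` I -> measurable_fun B (EFin \o f).
  move=> mB BI; apply/measurable_EFinP; apply: (measurable_funS mD) => //.
  exact: subset_trans ID.
have base : (P (E I) = \int[mu]_(x in I) (f x)%:E)%E by rewrite Eoc incr.
pose PP (B : set R) := (P (E (B `&` I)) = \int[mu]_(x in B `&` I) (f x)%:E)%E.
suff H : forall B, <<s @ocitv R >> B -> PP B by move=> mA; exact: (H A mA).
apply: (@dynkin_induction _ (measurableTypeR R) (@ocitv R) PP) => //; rewrite /PP.
- exact: ocitvI.
- by rewrite setTI.
- move=> _ [[x y] _ <-] /=.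
  have -> : `]x, y]%classic `&` `]s, t]%classic = `]Num.max x s, Num.min y t]%classic.
    apply/seteqP; split => z /=; rewrite !in_itv/= gt_max le_min.
      by move=> [/andP[-> ->] /andP[-> ->]].
    by move=> /andP[/andP[-> ->] /andP[-> ->]].
  have [mM|Mm] := leP (Num.max x s) (Num.min y t); last first.
    have -> : `]Num.max x s, Num.min y t]%classic = set0 :> set R.
      apply/seteqP; split => // z /=; rewrite in_itv/= => /andP[h1 h2].
      by have := lt_trans Mm (lt_le_trans h1 h2); rewrite ltxx.
    by rewrite integral_set0 (_ : E set0 = set0) ?measure0//; apply/seteqP; split => // w [].
  have sM : s <= Num.max x s by rewrite le_max lexx orbT.
  have mt : Num.min y t <= t by rewrite ge_min lexx orbT.
  rewrite Eoc; apply: incr => //.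
    exact: convD Ds Dt sM (le_trans mM mt).
  exact: convD Ds Dt (le_trans sM mM) mt.
- clear A; move=> A mA HA.
  have mAI : measurable (A `&` I) by apply: measurableI => //; exact: measurable_itv.
  have mCI : measurable (~` A `&` I).
    by apply: measurableI; [exact: measurableC|exact: measurable_itv].
  have Isplit : I = (A `&` I) `|` (~` A `&` I) by rewrite -setIUl setUv setTI.
  have dis : (A `&` I) `&` (~` A `&` I) = set0.
    by rewrite -subset0 => x [[Ax _] [nAx _]].
  have PI : (P (E I) = P (E (A `&` I)) + P (E (~` A `&` I)))%E.
    rewrite {1}Isplit -measureU//; [|exact: mE|exact: mE|exact: E_disj].
    congr (P _); apply/seteqP; split => w /=.
      by move=> [x [h|h] xw]; [left|right]; exists x.
    by move=> [[x h xw]|[x h xw]]; exists x => //; [left|right].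
  have II : (\int[mu]_(x in I) (f x)%:E = \int[mu]_(x in A `&` I) (f x)%:E + \int[mu]_(x in ~` A `&` I) (f x)%:E)%E.
    rewrite {1}Isplit integral_setU//.
    - by rewrite -Isplit; apply: mfI => //; exact: measurable_itv.
    - exact/disj_set2P.
  have fin B : measurable B -> P (E B) \is a fin_num.
    move=> mB; rewrite ge0_fin_numE//; apply: le_lt_trans (probability_le1 P (mE mB)) _.
    exact: ltry.
  have P1 : P (E (A `&` I)) \is a fin_num by exact: fin.
  move: base; rewrite PI II -HA => h.
  by rewrite -[LHS](addeK _ P1) -[RHS](addeK _ P1); congr (_ - _)%E; rewrite [LHS]addeC h addeC.
- move=> F mF tF HF; rewrite setI_bigcupl; apply: density_bigcup => //.
  + by move=> n; apply: measurableI => //; exact: mF.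
  + exact: trivIset_setIr.
  + by move=> n x [_ /ID].
Qed.

(** Since [D] is open, intervals ]p, q] with rational ends in [D] cover it. They are enumerated by
    [unpickle], codes of no such pair giving the empty set, and made disjoint by [seqDU]. *)
Lemma density_of_increments : measurable_fun D f /\ forall A : set R, measurable A -> A `<=` D ->
    P [set w | (EFin @` A) (X w)] = (\int[mu]_(x in A) (f x)%:E)%E.
Proof.
split => // A mA AD.
pose I n : set R := if unpickle n is Some pq then
  if `[< D (ratr pq.1) /\ D (ratr pq.2) >] then `]ratr pq.1, ratr (pq : rat * rat).2]%classic else set0
  else set0.
have ID n : I n `<=` D.
  rewrite /I; case: unpickle => [[p q]|]/=; last exact: sub0set.
  by case: asboolP => [[Dp Dq]|_]; [exact: ocD|exact: sub0set].
have mI n : measurable (I n).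
  rewrite /I; case: unpickle => [[p q]|]/=; last exact: measurable0.
  by case: asboolP => _; [exact: measurable_itv|exact: measurable0].
have cover : D `<=` \bigcup_n I n.
  move=> x Dx; have [e e0 De] := nbhsD Dx.
  have [p] := @rat_in_itvoo _ (x - e) x (ltac:(lra)).
  have [q] := @rat_in_itvoo _ x (x + e) (ltac:(lra)).
  rewrite !in_itv/= => /andP[xq qe] /andP[ep px].
  have Dpq : D (ratr p) /\ D (ratr q).
    by split; apply: De; rewrite ltr_norml; apply/andP; split; lra.
  have Ipq : I (pickle (p, q)) = `]ratr p, ratr q]%classic.
    by rewrite /I pickleK; cbv beta iota; rewrite asboolT.
  exists (pickle (p, q)); first exact: Logic.I.
  by rewrite Ipq /= in_itv/= px ltW.
pose J n := A `&` seqDU I n.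
have mJ n : measurable (J n).
  by apply: measurableI => //; apply: measurableD => //; exact: bigsetU_measurable.
have JE : A = \bigcup_n J n.
  by rewrite -setI_bigcupr -seqDU_bigcup_eq; apply/esym/setIidl; exact: subset_trans cover.
rewrite -/(E A) JE; apply: density_bigcup => //.
- by apply: trivIset_setIl; exact: trivIset_seqDU.
- by move=> n x [/AD].
- move=> n; have JI : J n `<=` I n by move=> x [_ []].
  rewrite -(setIidl JI) /I; case: unpickle => [[p q]|]/=; last first.
    by rewrite setI0 integral_set0 (_ : E set0 = set0) ?measure0//; apply/seteqP; split => // w [].
  case: asboolP => [[Dp Dq]|_]; first exact: density_oc.
  by rewrite setI0 integral_set0 (_ : E set0 = set0) ?measure0//; apply/seteqP; split => // w [].
Qed.

End density_from_increments.

Section affine_substitution.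
Context (R : realType).
Notation mu := (@lebesgue_measure R).
Variables (g : R -> R) (a b s t : R) (st : s <= t).
Hypothesis cg : forall y, s <= y -> y <= t -> {for (y - a) / b, continuous g}.

Let F (y : R) : R := (y - a) / b.

Let dF (y : R) : is_derive y 1 F b^-1.
Proof.
have -> : F = b^-1 \*: ((@id R) - cst a).
  by apply/funext => z; rewrite /F mulrC.
have := is_deriveZ b^-1 (is_deriveB (is_derive_id y 1) (is_derive_cst a y 1)).
by rewrite subr0 [_ *: _]mulr1.
Qed.

Let F'E : F^`()%classic = cst b^-1.
Proof. by apply/funext => y; rewrite derive1E; exact: (@derive_val _ _ _ _ _ _ _ (dF y)). Qed.

Let cF : continuous F.
Proof.
by move=> y; apply: differentiable_continuous; apply/derivable1_diffP; have [] := dF y.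
Qed.

Let F_LR : derivable_oo_LRcontinuous F s t.
Proof.
split; first by move=> y _; have [] := dF y.
- by apply: cvg_at_right_filter; exact: cF.
- by apply: cvg_at_left_filter; exact: cF.
Qed.

Lemma integral_affine_pos : 0 < b ->
  (\int[mu]_(x in `[((s - a) / b)%R, ((t - a) / b)%R]) (g x)%:E =
   \int[mu]_(y in `[s, t]) (b^-1 * g ((y - a) / b))%:E)%E.
Proof.
move=> b0; rewrite (@integration_by_substitution_increasing _ F g s t)//.
- by apply: eq_integral => y _; rewrite F'E /= mulrC.
- by move=> x y _ _ xy; rewrite /F ltr_pM2r ?invr_gt0// ltrD2r.
- by rewrite F'E => y _; exact: cvg_cst.
- by rewrite F'E; exact: is_cvg_cst.
- by rewrite F'E; exact: is_cvg_cst.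
- apply: continuous_in_subspaceT => x; rewrite inE/= in_itv/= => /andP[h1 h2].
  have -> : x = ((b * x + a) - a) / b by rewrite addrK mulrC mulKf ?gt_eqF.
  move: h1 h2; rewrite /F ler_pdivrMr// ler_pdivlMr// => h1 h2; apply: cg; lra.
Qed.

Lemma integral_affine_neg : b < 0 ->
  (\int[mu]_(x in `[((t - a) / b)%R, ((s - a) / b)%R]) (g x)%:E =
   \int[mu]_(y in `[s, t]) (`|b|^-1 * g ((y - a) / b))%:E)%E.
Proof.
move=> b0; rewrite (@integration_by_substitution_decreasing _ F g s t)//.
- by apply: eq_integral => y _; rewrite F'E /= ltr0_norm// invrN mulrC.
- by move=> x y _ _ xy; rewrite /F ltr_nM2r ?invr_lt0// ltrD2r.
- by rewrite F'E => y _; exact: cvg_cst.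
- by rewrite F'E; exact: is_cvg_cst.
- by rewrite F'E; exact: is_cvg_cst.
- apply: continuous_in_subspaceT => x; rewrite inE/= in_itv/= => /andP[h1 h2].
  have -> : x = ((b * x + a) - a) / b by rewrite addrK mulrC mulKf ?lt_eqF.
  move: h1 h2; rewrite /F ler_ndivrMr// ler_ndivlMr// => h1 h2; apply: cg; lra.
Qed.

End affine_substitution.

(** * Transfer to the law of reflecting Brownian motion *)

Section hitting_law.
Context (R : realType) (P : probability (path_space R) R) (hP : is_RBM0_law P).
Variables (a b : R) (a0 : 0 < a).
Notation mu := (@lebesgue_measure R).
Local Notation H := (hitting_time a b : path_space R -> \bar R).
Local Notation D := (admissible a b).
Implicit Types (u s t y r : R).

Let mH : measurable_fun setT H. Proof. exact: measurable_hitting_time. Qed.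

Let mH_gt u : measurable [set w : path_space R | (u%:E < H w)%E].
Proof.
rewrite -[X in measurable X]setTI.
exact: (emeasurable_fun_o_infty measurableT mH).
Qed.

(** Both events are pulled back along [X] and compared on actual trajectories |B|; this encodes that
    almost every path is nonnegative and starts at 0. *)
Let law_eq (A A' : set (path_space R)) : measurable A -> measurable A' ->
  (forall w : cts_path R, path_fun w 0 = 0 -> (forall t, 0 <= path_fun w t) -> A w <-> A' w) ->
  P A = P A'.
Proof.
move: hP => [disp [Om [Q [B [X [hB XB PX]]]]]] mA mA' AA'.
rewrite !PX// /distribution /pushforward; congr (Q _).
have XA o : A (X o) <-> A' (X o).
  apply: AA' => [|t]; last by rewrite /path_fun XB.
  by rewrite /path_fun XB -[X in `|X|]/(bm B o 0) bm0 ?normr0.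
by apply/seteqP; split => o /= /XA.
Qed.

Let as_path (A : set (path_space R)) : measurable A ->
  (forall w : cts_path R, path_fun w 0 = 0 -> (forall t, 0 <= path_fun w t) -> A w) -> P A = 1%E.
Proof.
move=> mA HA; rewrite -(@probability_setT _ _ _ P); apply: (law_eq mA measurableT) => w w0 wge0.
by split => // _; exact: HA.
Qed.

Lemma survival_probability_cvg u : D u ->
  (sym_sum (survival_term a b u) N)%:E @[N --> \oo] --> P [set w | (u%:E < H w)%E].
Proof.
move=> /(admissibleE b a0)[u0 c0].
move: hP => [disp [Om [Q [B [X [hB XB PX]]]]]].
rewrite (PX _ (mH_gt u)).
rewrite /distribution /pushforward.
rewrite (_ : _ @^-1` _ = [set o | forall t, 0 <= t <= u -> excess B a b o t < 0]).
  by rewrite (no_crossing_probability hB a0 u0 c0); exact: survival_cvg.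
have gapE o t : gap a b (X o) t = excess B a b o t by rewrite /gap /path_fun XB.
apply/seteqP; split => o /=.
  move=> /lt_hitting_time/gap_neq0 -/(_ (ltW u0))[h|h] t tu; first by rewrite -gapE h.
  (* A positive gap throughout is impossible, as the gap at time 0 is [- a]. *)
  have := h 0; rewrite lexx (ltW u0) gapE excess0// => /(_ isT); by rewrite oppr_gt0 ltNge (ltW a0).
move=> h; apply/lt_hitting_time/gap_neq0; first exact: ltW.
by left => t tu; rewrite gapE h.
Qed.

Let Pgt u := fine (P [set w | (u%:E < H w)%E]).

Let PgtE u : P [set w | (u%:E < H w)%E] = (Pgt u)%:E.
Proof.
rewrite fineK// ge0_fin_numE//; apply: le_lt_trans (probability_le1 P (mH_gt u)) _.
exact: ltry.
Qed.

Let survival_limR u : D u -> sym_sum (survival_term a b u) N @[N --> \oo] --> Pgt u.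
Proof. by move=> /survival_probability_cvg; rewrite PgtE => /fine_cvg. Qed.

Let open_D : open D.
Proof.
rewrite (_ : D = [set u | 0 < u] `&` [set u | 0 < a + b * u]); last first.
  by apply/seteqP; split => u /= /(admissibleE b a0).
apply: openI; first exact: open_gt.
apply: (@open_comp _ _ (fun u => a + b * u) [set x | 0 < x]); last exact: open_gt.
move=> x _; apply: cvgD; first exact: cvg_cst.
by apply: cvgM; [exact: cvg_cst|exact: cvg_id].
Qed.

Let conv_D x y z : D x -> D y -> x <= z -> z <= y -> D z.
Proof.
move=> [x0 _] [y0 yb] xz zy; split; first exact: lt_le_trans xz.
by move=> /yb; exact: le_lt_trans.
Qed.

Let continuous_Delta u : D u -> {for u, continuous (Delta a b)}.
Proof.
move=> Du; have /(admissibleE b a0)[u0 c0] := Du.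
(* The series estimates are stated up to a right end where the boundary is still positive; openness
   of [D] supplies one beyond [u]. *)
have /nbhs_ballP[e /= e0 He] : nbhs u D by exact: open_nbhs_nbhs.
have De : D (u + e / 2).
  by apply: He; rewrite /ball/= opprD addrA subrr sub0r normrN gtr0_norm ?divr_gt0//; lra.
have /(admissibleE b a0)[_ ce] := De.
apply: cvgM; first exact: continuous_Delta_factor.
apply: (continuous_bilateral_Delta a0 (s := u / 2) (t := u + e / 2)) => //; lra.
Qed.

Let hitting_increment s t : D s -> D t -> s <= t ->
  P [set w | (s%:E < H w)%E /\ (H w <= t%:E)%E] = (\int[mu]_(x in `]s, t]) (Delta a b x)%:E)%E.
Proof.
move=> Ds Dt st; have [s0 _] := Ds; have /(admissibleE b a0)[_ ct] := Dt.
rewrite (survival_increment a0 s0 ct st (survival_limR Ds) (survival_limR Dt)).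
rewrite EFinB -!PgtE (_ : [set _ | _ /\ _] = [set w | (s%:E < H w)%E] `\` [set w | (t%:E < H w)%E]); last first.
  by apply/seteqP; split => w [h1 h2]; split => //; [apply/negP; rewrite -leNgt|rewrite leNgt; apply/negP].
have fin : (P [set w | (s%:E < H w)%E] < +oo)%E by rewrite PgtE ltry.
apply: (etrans (measureD (mH_gt s) (mH_gt t) fin)).
congr (_ - P _)%E; apply/seteqP; split => w; first by move=> [].
by move=> h; split => //; apply: le_lt_trans h; rewrite lee_fin.
Qed.

Lemma hitting_time_density : has_density_on P H D (Delta a b).
Proof. exact: density_of_increments. Qed.

Let path_at_hitE (w : cts_path R) : path_at_hit a b w =
  if hitting_time a b w is r%:E then (a + b * r)%:E else +oo%E.
Proof.
rewrite /path_at_hit; case Hw : (hitting_time a b w) => [r| |] //.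
by have [_ <-] := hitting_time_attained Hw.
Qed.

Let hit_gt0 (w : cts_path R) : path_fun w 0 = 0 -> (0 < hitting_time a b w)%E.
Proof.
move=> w0; apply/lt_hitting_time => t /andP[t0 t1].
have -> : t = 0 by apply/eqP; rewrite eq_le t0 t1.
by rewrite /gap w0 mulr0 addr0 sub0r oppr_eq0 gt_eqF.
Qed.

Let lt_path_at_hit_pos (w : cts_path R) y : 0 < b ->
  (y%:E < path_at_hit a b w)%E = (((y - a) / b)%:E < hitting_time a b w)%E.
Proof.
move=> b0; rewrite path_at_hitE; have := hitting_time_ge0 a b w.
case: (hitting_time a b w) => [r| |] // _; last by rewrite !ltry.
by rewrite !lte_fin ltr_pdivrMr// ltrBlDl mulrC.
Qed.

(** For a path that never hits, the position is +oo and not below [y], whence the finiteness clause;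
    [hit_finite] removes it under the law. *)
Let path_at_hit_lt_neg (w : cts_path R) y : b < 0 ->
  (path_at_hit a b w < y%:E)%E = (((y - a) / b)%:E < hitting_time a b w < +oo)%E.
Proof.
move=> b0; rewrite path_at_hitE; have := hitting_time_ge0 a b w.
case: (hitting_time a b w) => [r| |] // _; last by rewrite ltxx andbF.
by rewrite !lte_fin ltry andbT ltr_ndivrMr// ltrBrDl mulrC.
Qed.

Let measurable_path_at_hit : b != 0 ->
  measurable_fun setT (path_at_hit a b : path_space R -> \bar R).
Proof.
move=> bn0; apply: (measurability _ (ErealGenOInfty.measurableE R)) => _ [_ [y ->] <-].
rewrite setTI; have [b0|b0|b0] := ltgtP b 0; last by rewrite b0 eqxx in bn0.
- rewrite [X in measurable X](_ : _ = ~` [set w | (H w < +oo)%E] `|` [set w | (H w < ((y - a) / b)%:E)%E]).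
    apply: measurableU; first apply: measurableC.
      rewrite -[X in measurable X]setTI; exact: (emeasurable_fun_infty_o measurableT mH).
    rewrite -[X in measurable X]setTI; exact: (emeasurable_fun_infty_o measurableT mH).
  have Hlt w r : H w = r%:E -> (y < a + b * r) = (r < (y - a) / b).
    by move=> _; rewrite ltr_ndivlMr// ltrBlDl mulrC.
  apply/seteqP; split => w /=; rewrite in_itv/= andbT path_at_hitE; have := hitting_time_ge0 a b w; case Hw : (hitting_time a b w) => [r| |] // _.
  + by rewrite !lte_fin (Hlt w)// => h; right.
  + by move=> _; left; rewrite ltxx.
  + by rewrite !lte_fin (Hlt w)// => -[/(_ (ltry r))|].
  + by rewrite ltry.
- rewrite [X in measurable X](_ : _ = [set w | (((y - a) / b)%:E < H w)%E]); first exact: mH_gt.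
  by apply/seteqP; split => w /=; rewrite in_itv/= andbT lt_path_at_hit_pos.
Qed.

Lemma path_at_hit_gt y : 0 < b ->
  P [set w | (y%:E < path_at_hit a b w)%E] =
  if a < y then P [set w | (((y - a) / b)%:E < H w)%E] else 1%E.
Proof.
move=> b0; have -> : [set w : path_space R | (y%:E < path_at_hit a b w)%E] =
    [set w | (((y - a) / b)%:E < H w)%E].
  by apply/seteqP; split => w /=; rewrite lt_path_at_hit_pos.
case: ltP => // ya; apply: as_path; first exact: mH_gt.
move=> w w0 _ /=; apply: le_lt_trans (hit_gt0 w0).
by rewrite lee_fin pmulr_lle0 ?invr_gt0// subr_le0.
Qed.

(** The line descends to 0 at time - a / b, so a nonnegative path starting below it has met it by
    then. *)
Let hit_finite (w : cts_path R) : b < 0 -> (forall t, 0 <= path_fun w t) ->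
  path_fun w 0 = 0 -> (hitting_time a b w < +oo)%E.
Proof.
move=> b0 wge0 w0; apply: (@le_lt_trans _ _ (- a / b)%:E); last exact: ltry.
have ab0 : 0 <= - a / b by rewrite mulr_le0// ?oppr_le0 ?invr_le0 ltW.
rewrite leNgt; apply/negP => /lt_hitting_time/gap_neq0 -/(_ ab0)[h|h].
  have := h (- a / b); rewrite ab0 lexx => /(_ isT).
  rewrite /gap mulrCA mulfV ?lt_eqF// mulr1 subrr subr0 => h'.
  by have := le_lt_trans (wge0 _) h'; rewrite ltxx.
have := h 0; rewrite lexx ab0 => /(_ isT).
by rewrite /gap w0 mulr0 addr0 sub0r oppr_gt0 ltNge ltW.
Qed.

Lemma path_at_hit_lt y : b < 0 ->
  P [set w | (path_at_hit a b w < y%:E)%E] =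
  if y < a then P [set w | (((y - a) / b)%:E < H w)%E] else 1%E.
Proof.
move=> b0.
have mfin : measurable [set w : path_space R | (H w < +oo)%E].
  rewrite -[X in measurable X]setTI; exact: (emeasurable_fun_infty_o measurableT mH).
have -> : [set w : path_space R | (path_at_hit a b w < y%:E)%E] =
    [set w | (((y - a) / b)%:E < H w)%E] `&` [set w | (H w < +oo)%E].
  by apply/seteqP; split => w /=; rewrite path_at_hit_lt_neg// => /andP.
have -> : P ([set w | (((y - a) / b)%:E < H w)%E] `&` [set w | (H w < +oo)%E]) =
    P [set w | (((y - a) / b)%:E < H w)%E].
  apply: law_eq => //; first by apply: measurableI => //; exact: mH_gt.
  by move=> w w0 wge0; split => [[]|h] //; split => //; exact: hit_finite.
case: ltP => // ay; apply: as_path; first exact: mH_gt.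
move=> w w0 _ /=; apply: le_lt_trans (hit_gt0 w0).
by rewrite lee_fin nmulr_lle0 ?invr_lt0// subr_ge0.
Qed.

Let mDelta (A : set R) : measurable A -> A `<=` D -> measurable_fun A (EFin \o Delta a b).
Proof.
move=> mA AD; apply/measurable_EFinP; apply: (measurable_funS _ AD).
  exact: open_measurable.
by have [] := hitting_time_density.
Qed.

Let oc_cc (f : R -> R) (s t : R) : (forall y, s <= y -> y <= t -> {for y, continuous f}) ->
  (\int[mu]_(y in `]s, t]) (f y)%:E = \int[mu]_(y in `[s, t]) (f y)%:E)%E.
Proof.
move=> cf; rewrite integral_itv_obnd_cbnd//.
apply/measurable_EFinP; apply: (@measurable_funS _ _ _ _ `[s, t]%classic) => //.
  exact: subset_itv_oc_cc.
apply: subspace_continuous_measurable_fun => //.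
by apply: continuous_in_subspaceT => u; rewrite inE/= in_itv/= => /andP[su ut]; exact: cf.
Qed.

Let continuous_Delta_affine (k y : R) : D ((y - a) / b) ->
  {for y, continuous (fun y => k * Delta a b ((y - a) / b))}.
Proof.
move=> Dy; apply: cvgM; first exact: cvg_cst.
apply: (@continuous_comp _ _ _ (fun y => (y - a) / b) (Delta a b)); last exact: continuous_Delta.
by apply: cvgM; [apply: cvgB; [exact: cvg_id|exact: cvg_cst]|exact: cvg_cst].
Qed.

Lemma path_at_hit_density_pos : 0 < b ->
  has_density_on P (path_at_hit a b) [set y | a < y] (fun y => b^-1 * Delta a b ((y - a) / b)).
Proof.
move=> b0.
have DD y : a < y -> D ((y - a) / b).
  by move=> ay; split; [rewrite divr_gt0// subr_gt0|rewrite ltNge ltW].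
apply: density_of_increments.
- by apply: measurable_path_at_hit; rewrite gt_eqF.
- exact: open_gt.
- by move=> x y z /= ax _ xz _; exact: lt_le_trans xz.
- by move=> y /= ay; apply: continuous_Delta_affine; exact: DD.
move=> s t /= As At st.
have pq : (s - a) / b <= (t - a) / b by rewrite ler_pM2r ?invr_gt0// lerD2r.
have Dy y : s <= y -> D ((y - a) / b) by move=> sy; apply: DD; exact: lt_le_trans sy.
rewrite oc_cc; last by move=> y sy _; apply: continuous_Delta_affine; exact: Dy.
rewrite -integral_affine_pos//; last by move=> y sy _; apply: continuous_Delta; exact: Dy.
rewrite -oc_cc; last first.
  by move=> r pr rq; apply: continuous_Delta; exact: (conv_D (DD _ As) (DD _ At)).
rewrite -(hitting_increment (DD _ As) (DD _ At) pq); congr (P _).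
by apply/seteqP; split => w /=; rewrite !leNgt !lt_path_at_hit_pos.
Qed.

Lemma path_at_hit_density_neg : b < 0 ->
  has_density_on P (path_at_hit a b) [set y | 0 < y < a] (fun y => `|b|^-1 * Delta a b ((y - a) / b)).
Proof.
move=> b0.
have DD y : 0 < y -> y < a -> D ((y - a) / b).
  move=> y0 ya; apply/(admissibleE b a0).
  split; first by rewrite nmulr_rgt0 ?subr_lt0// invr_lt0.
  by rewrite mulrCA mulfV ?lt_eqF// mulr1 addrC subrK.
apply: density_of_increments.
- by apply: measurable_path_at_hit; rewrite lt_eqF.
- rewrite (_ : [set _ | _] = [set y | 0 < y] `&` [set y | y < a]).
    by apply: openI; [exact: open_gt|exact: open_lt].
  by apply/seteqP; split => y /= /andP.
- move=> x y z /= /andP[x0 _] /andP[_ ya] xz zy.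
  by rewrite (lt_le_trans x0 xz) (le_lt_trans zy ya).
- by move=> y /= /andP[y0 ya]; apply: continuous_Delta_affine; exact: DD.
move=> s t /= /andP[s0 sa] /andP[t0 ta] st.
have Dy y : s <= y -> y <= t -> D ((y - a) / b).
  by move=> sy yt; apply: DD; [exact: lt_le_trans sy|exact: le_lt_trans ta].
rewrite oc_cc; last by move=> y sy yt; apply: continuous_Delta_affine; exact: Dy.
rewrite -integral_affine_neg//; last by move=> y sy yt; apply: continuous_Delta; exact: Dy.
(* A decreasing substitution turns ]s, t] into an interval closed on the left, so the density
   statement for general sets is used instead of [hitting_increment]. *)
pose A := `[(t - a) / b, (s - a) / b[%classic.
have AD : A `<=` D.
  move=> r; rewrite /A /= in_itv/= => /andP[pr rq].
  by apply: (conv_D (DD _ t0 ta) (DD _ s0 sa)) => //; exact: ltW.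
rewrite -integral_itv_bndo_bndc; last by apply: mDelta => //; exact: measurable_itv.
have [_ HD] := hitting_time_density; rewrite -(HD A (measurable_itv _) AD).
congr (P _); apply/seteqP; split => w /=; rewrite path_at_hitE.
  case Hw : (hitting_time a b w) => [r| |]; [|by move=> []|by have := hitting_time_ge0 a b w; rewrite Hw].
  rewrite lte_fin lee_fin => -[h1 h2]; exists r => //.
  by rewrite /A /= in_itv/= ler_ndivrMr// ltr_ndivlMr//; apply/andP; split; lra.
move=> [r + rw]; rewrite -rw /A /= in_itv/= ler_ndivrMr// ltr_ndivlMr// lte_fin lee_fin => /andP[h1 h2].
by split; lra.
Qed.

End hitting_law.

Theorem theorem9 (R : realType) (P : probability (path_space R) R)
    (hP : is_RBM0_law P) (a b : R) (ha : 0 < a) :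
  (forall u : R, admissible a b u ->
     (fun N : nat => (sym_sum (survival_term a b u) N)%:E) @ \oo
       --> P [set w | (u%:E < hitting_time a b w)%E])
  /\ (forall u : R, admissible a b u -> bilateral_cvg (Delta_term a b u))
  /\ has_density_on P (hitting_time a b) (admissible a b) (Delta a b)
  /\ (0 < b ->
       (forall y : R,
          P [set w | (y%:E < path_at_hit a b w)%E]
          = if a < y then P [set w | (((y - a) / b)%:E < hitting_time a b w)%E]
            else 1%E)
       /\ has_density_on P (path_at_hit a b) [set y | a < y]
            (fun y => b^-1 * Delta a b ((y - a) / b)))
  /\ (b < 0 ->
       (forall y : R,
          P [set w | (path_at_hit a b w < y%:E)%E]
          = if y < a then P [set w | (((y - a) / b)%:E < hitting_time a b w)%E]
            else 1%E)
       /\ has_density_on P (path_at_hit a b) [set y | 0 < y < a]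
            (fun y => `|b|^-1 * Delta a b ((y - a) / b))).
Proof.
split; first by move=> u; exact: survival_probability_cvg.
split.
  move=> u /(admissibleE b ha)[u0 cu].
  exact: bilateral_cvg_Delta_term u0 cu u (lexx u) (lexx u).
split; first exact: hitting_time_density.
split => b0; split.
- by move=> y; exact: path_at_hit_gt.
- exact: path_at_hit_density_pos.
- by move=> y; exact: path_at_hit_lt.
- exact: path_at_hit_density_neg.
Qed.
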